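(* Let $d\ge2$ and $\theta\in(0,1]$. Let $\mathcal X$ and $\mathcal Y$ be compact convex subsets of $\mathbb R^d$ with nonempty interior. There exist a probability measure $\rho$ on $\mathcal X$ satisfying, for some $M>0$, $\rho(B_\eta(x))\le M\eta^{d-1+\theta}$ for every $x\in\mathbb R^d$ and $\eta>0$, and measures $\mu_0,(\mu_i)_{i\ge1}$ in $\mathcal P(\mathcal Y)$, such that for any $q\in[1,\infty)$, $r\in[1,\infty]$ and $$\alpha>\begin{cases}\frac{r\theta}{q(r+\theta)}&r<\infty,\\ \frac\theta q&r=\infty,\end{cases}$$ denoting by $\gamma_{\rho\to\mu_i}\in\Gamma(\rho,\mu_i)$ the unique optimal transport plan ($i\ge0$), $$\limsup_{i\to\infty}\frac{W_q(\gamma_{\rho\to\mu_0},\gamma_{\rho\to\mu_i})}{W_r(\mu_0,\mu_i)^\alpha}=\infty.$$ Consequently the exponents are sharp in the following estimates, for compact convex $\mathcal X,\mathcal Y$ and $\rho_0\in\mathcal P(\mathcal X)$ satisfying $\rho_0(B_\eta(x))\le M\eta^{d-1+\theta}$ for all $x\in\mathbb R^d$, $\eta>0$ (i.e. they do not hold in general with a larger exponent and a finite constant $C$ independent of $\rho_1,\mu_0,\mu_1$): for all $\rho_1\in\mathcal P(\mathcal X)$, $\mu_0,\mu_1\in\mathcal P(\mathcal Y)$, (i) $\|\nabla\phi_{\rho_0\to\mu_0}-\nabla\phi_{\rho_1\to\mu_1}\|_{L^q(\rho_0)}\le C\big(W_1(\rho_0,\rho_1)+W_1(\mu_0,\mu_1)\big)^{\frac{\theta}{q(1+\theta)}}$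 for Brenier potentials $\phi_{\rho_i\to\mu_i}$; (ii) $W_q(\gamma_{\rho_0\to\mu_0},\gamma_{\rho_1\to\mu_1})\le C\big(W_1(\rho_0,\rho_1)+W_1(\mu_0,\mu_1)\big)^{\frac{\theta}{q(1+\theta)}}$ for optimal plans $\gamma_{\rho_i\to\mu_i}\in\Gamma(\rho_i,\mu_i)$.
   Context: $\mathcal P(E)$ is the set of Borel probability measures on $E$, and $B_\eta(x)$ is the open Euclidean ball. $\Pi(\rho,\mu)$ is the set of couplings of $\rho$ and $\mu$, and $\Gamma(\rho,\mu)$ is the set of minimisers of $\int\|x-y\|^2\,d\gamma(x,y)$ over $\gamma\in\Pi(\rho,\mu)$ (optimal plans); under the stated condition on $\rho$ the optimal plan is unique and induced by a map (Brenier-McCann). For $r\in[1,\infty]$ and measures on $\mathbb R^d$, $W_r(\rho,\mu)=\min_{\gamma\in\Pi(\rho,\mu)}\|x-y\|_{L^r(\gamma)}$. For probability measures $\gamma_0,\gamma_1$ on $\mathbb R^d\times\mathbb R^d$, $W_q^q(\gamma_0,\gamma_1)=\inf_{\pi\in\Pi(\gamma_0,\gamma_1)}\int\|x_0-x_1\|^q+\|y_0-y_1\|^q\,d\pi(x_0,y_0,x_1,y_1)$. A Brenier potential for $\rho\to\mu$ is a minimiser $\phi$ of $\inf_{\phi\text{ convex}}\int\phi\,d\rho+\int\phi^*\,d\mu$, always taken, together with its dual potential $\psi$, of the form $\phi(x)=\sup_{y\in\mathcal Y}\langle x,y\rangle-\psi(y)$, $\psi(y)=\sup_{x\in\mathcal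 X}\langle x,y\rangle-\phi(x)$. When $\rho$ satisfies the stated ball condition, $\nabla\phi_{\rho\to\mu}$ is defined $\rho$-a.e. and is the optimal transport map from $\rho$ to $\mu$. *)

(* Defs.v *)
From HB Require Import structures.
From mathcomp Require Import all_boot all_order all_algebra.
From mathcomp Require Import all_classical all_reals all_analysis.

Set Implicit Arguments.
Unset Strict Implicit.
Unset Printing Implicit Defensive.

Import Order.TTheory GRing.Theory Num.Theory.
Import numFieldNormedType.Exports.

Local Open Scope classical_set_scope.
Local Open Scope ring_scope.

(* The library norm on ['rV[R]_d] is the sup norm, so the Euclidean inner
   product, norm and balls are introduced here; both norms induce the same
   topology, hence the same Borel sets. *)
Notation borel_rV R d := (g_sigma_algebraType (@open 'rV[R]_d)).

Section Euclidean.
Context {R : realType} {d : nat}.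
Implicit Types x y : 'rV[R]_d.

Definition dotv x y : R := \sum_(i < d) x ord0 i * y ord0 i.

Definition enorm x : R := Num.sqrt (dotv x x).

Definition eball x (eta : R) : set (borel_rV R d) :=
  [set y : 'rV[R]_d | enorm (y - x) < eta].

(* Total function, with unspecified values where a partial derivative fails to
   exist: for a convex potential and a measure satisfying [ball_growth] below,
   this only happens on a null set. *)
Definition grad (phi : 'rV[R]_d -> R) x : 'rV[R]_d :=
  \row_(i < d) 'D_(delta_mx ord0 i) (phi : 'rV[R]_d -> R^o) x.

End Euclidean.

Section Couplings.
Context {d1 d2 : measure_display} {T1 : measurableType d1}
  {T2 : measurableType d2} {R : realType}.

Definition coupling (rho : probability T1 R) (mu : probability T2 R)
    (gamma : probability (T1 * T2)%type R) : Prop :=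
  (forall A, measurable A -> pushforward gamma fst A = rho A) /\
  (forall B, measurable B -> pushforward gamma snd B = mu B).

End Couplings.

Section OptimalTransport.
Context {R : realType} {d : nat}.
Local Notation E := (borel_rV R d).
Local Open Scope ereal_scope.

(* Membership in P(A) for a Borel set [A], the measure being extended by zero
   to the whole space. *)
Definition prob_on (A : set 'rV[R]_d) (rho : probability E R) : Prop :=
  rho A = 1.

Definition ball_growth (theta : R) (rho : probability E R) : Prop :=
  exists2 M : R, (0 < M)%R & forall (x : 'rV[R]_d) (eta : R), (0 < eta)%R ->
    rho (eball x eta) <= (M * eta `^ (d%:R - 1 + theta))%:E.

Definition quadratic_cost (gamma : probability (E * E)%type R) : \bar R :=
  \int[gamma]_z (enorm (z.1 - z.2) ^+ 2)%:E.

Definition optimal_plan (rho mu : probability E R)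
    (gamma : probability (E * E)%type R) : Prop :=
  coupling rho mu gamma /\
  forall gamma', coupling rho mu gamma' ->
    quadratic_cost gamma <= quadratic_cost gamma'.

(* Uniqueness is equality on measurable sets, the only ones on which a measure
   is meaningful. *)
Definition unique_optimal_plan (rho mu : probability E R)
    (gamma : probability (E * E)%type R) : Prop :=
  optimal_plan rho mu gamma /\
  forall gamma', optimal_plan rho mu gamma' ->
    forall A, measurable A -> gamma' A = gamma A.

(* The case r = +oo of [Lnorm] is the essential supremum. *)
Definition wasserstein (r : \bar R) (rho mu : probability E R) : \bar R :=
  ereal_inf [set Lnorm gamma r (fun z => (enorm (z.1 - z.2))%:E)
            | gamma in [set gamma | coupling rho mu gamma]].

Definition wasserstein_plan (q : R)
    (gamma0 gamma1 : probability (E * E)%type R) : \bar R :=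
  (ereal_inf [set \int[p]_z
      (enorm (z.1.1 - z.2.1) `^ q + enorm (z.1.2 - z.2.2) `^ q)%:E
    | p in [set p | coupling gamma0 gamma1 p]]) `^ q^-1.

Definition conjugate (phi : 'rV[R]_d -> R) (y : 'rV[R]_d) : \bar R :=
  ereal_sup [set (dotv x y - phi x)%:E | x in [set: 'rV[R]_d]].

(* For convex [phi] and compactly supported [rho] the first integral is finite,
   and [conjugate phi] is bounded below by [- phi 0]: the sum is never of the
   form +oo - oo. *)
Definition kantorovich (rho mu : probability E R) (phi : 'rV[R]_d -> R)
    : \bar R :=
  \int[rho]_x (phi x)%:E + \int[mu]_y conjugate phi y.

(* The duality formulas, stated in the extended reals so that no supremum takes
   a default value, force [phi] to be finite on the whole space; hence the
   minimisation can be taken over finite convex functions. *)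
Definition brenier_potential (X Y : set 'rV[R]_d) (rho mu : probability E R)
    (phi : 'rV[R]_d -> R) : Prop :=
  [/\ convex_function setT phi,
      forall phi', convex_function setT phi' ->
        kantorovich rho mu phi <= kantorovich rho mu phi' &
      exists psi : 'rV[R]_d -> R,
        (forall x, (phi x)%:E = ereal_sup [set (dotv x y - psi y)%:E | y in Y])
        /\
        (forall y, (psi y)%:E = ereal_sup [set (dotv x y - phi x)%:E | x in X])].

(* Used for r in [1, +oo]; the second branch is r = +oo. *)
Definition critical_exponent (theta q : R) (r : \bar R) : R :=
  match r with
  | s%:E => (s * theta / (q * (s + theta)))%R
  | _ => (theta / q)%R
  end.

Definition potential_stability (X Y : set 'rV[R]_d) (rho0 : probability E R)
    (q beta C : R) : Prop :=
  forall (rho1 mu0 mu1 : probability E R) (phi0 phi1 : 'rV[R]_d -> R),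
    prob_on X rho1 -> prob_on Y mu0 -> prob_on Y mu1 ->
    brenier_potential X Y rho0 mu0 phi0 ->
    brenier_potential X Y rho1 mu1 phi1 ->
    Lnorm rho0 q%:E (fun x => (enorm (grad phi0 x - grad phi1 x))%:E) <=
      C%:E * (wasserstein 1 rho0 rho1 + wasserstein 1 mu0 mu1) `^ beta.

Definition plan_stability (X Y : set 'rV[R]_d) (rho0 : probability E R)
    (q beta C : R) : Prop :=
  forall (rho1 mu0 mu1 : probability E R)
      (gamma0 gamma1 : probability (E * E)%type R),
    prob_on X rho1 -> prob_on Y mu0 -> prob_on Y mu1 ->
    optimal_plan rho0 mu0 gamma0 ->
    optimal_plan rho1 mu1 gamma1 ->
    wasserstein_plan q gamma0 gamma1 <=
      C%:E * (wasserstein 1 rho0 rho1 + wasserstein 1 mu0 mu1) `^ beta.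

End OptimalTransport.

(* Main.v *)
From HB Require Import structures.
From mathcomp Require Import all_boot all_order all_algebra.
From mathcomp Require Import all_classical all_reals all_analysis.
From mathcomp Require Import measurable_realfun ess_sup_inf ring lra.
Require Import Defs.

Set Implicit Arguments.
Unset Strict Implicit.
Unset Printing Implicit Defensive.

Import Order.TTheory GRing.Theory Num.Theory.
Import numFieldNormedType.Exports.

Local Open Scope classical_set_scope.
Local Open Scope ring_scope.

(** The source measure concentrates ever closer to a hyperplane. Around an
    interior point [x0] of [X], write [p = x - x0] and let [p0] and [p1] be two
    coordinates of [p]. The measure [cusp] is a mixture of uniform measures on
    pairs of slabs
    [|p0| <= rr * width k] and [1 - gap k <= |p1| / rr <= 1 - 3 / 4 * gap k],
    where [gap k = 2^(-k)] and [width k = 2^(-k^2 / theta)], such that the slabs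
    of index at least [n] have the mass [tail n = width n ^ theta * gap n ^ 2].
    A slab of thickness [t] and mass [t ^ theta] is compatible with the growth
    condition ([cusp_growth]), and the powers of [gap n] are negligible against
    those of [width n].

    The potential [Delta * |p0|] splits every slab in halves along its median
    hyperplane and sends them to the two atoms [y0 +- Delta e0]. For large [n]
    it is replaced by its maximum with the two affine functions
    [+- (Delta * p0 + tau * p1) - tau * a], where [a] lies just before the slabs
    of index [n] and [tau] is of the order of [width n / gap n]. The two new
    pieces win on all the slabs beyond [a], on one side of [p1 = 0] each. There
    the sign of [p1], and no longer that of [p0], decides whether the mass goes
    near [y0 + Delta e0] or near [y0 - Delta e0]. Half of the mass [tail n]
    jumps by about [2 * Delta], which bounds from below the distance between
    the plans ([plan_wasserstein]) and between the gradients
    ([potential_distance]). The targets do not see this exchange, as the signs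
    of [p0] and [p1] have the same law on each slab ([untilted_law]). They
    differ by the displacement of the mass [tail n] over the short distance
    [tau] ([target_wasserstein]). Hence, up to powers of [gap n],
    [width n ^ (theta / q)] is compared with [width n ^ (1 + theta / r)], and
    the ratio of these two exponents is the critical exponent
    ([plan_gap_dominates]).

    All these potentials are maxima of finitely many affine functions, the
    maximum being strict almost everywhere up to equality of the slopes.
    Kantorovich duality then gives the optimal plan and its uniqueness
    ([unique_optimal_graph]), while double conjugation over [X] and [Y] turns
    the maximum into a Brenier potential with the same values on [X]
    ([bidual_brenier], [grad_bidual]). Both stability estimates, applied with
    the same source, would bound the distances of plans and of gradients by a
    power of the distance of the targets above the critical one. *)

(** * Integrals, laws and packed probability measures *)

Section MeasureTools.
Context {d1 d2 : measure_display} {T1 : measurableType d1}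
  {T2 : measurableType d2} {R : realType}.
Local Open Scope ereal_scope.

(** The integral of a nonnegative function is a supremum over the simple functions
below it, so it is monotone on all functions. Arbitrary convex functions, their
conjugates and their gradients are compared with explicit functions in this
way. *)
Lemma le_integral_nonmeas (mu : {measure set T1 -> \bar R}) (f g : T1 -> \bar R) :
  (forall x, f x <= g x) -> \int[mu]_x f x <= \int[mu]_x g x.
Proof.
move=> fg.
have ge0_mono (h k : T1 -> \bar R) : (forall x, 0 <= h x) ->
    (forall x, h x <= k x) -> \int[mu]_x h x <= \int[mu]_x k x.
  move=> h0 hk; rewrite !ge0_integralTE//; last first.
    by move=> x; exact: le_trans (hk x).
  apply: ge_ereal_sup => _ [s sh <-]; apply: ereal_sup_ubound.
  by exists s => // x; exact: le_trans (sh x) (hk x).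
rewrite [leLHS]integralE [leRHS]integralE; apply: leeB; apply: ge0_mono => // x.
  by rewrite !funeposE ge_max !le_max fg lexx orbT.
by rewrite !funenegE ge_max !le_max leeN2 fg lexx orbT.
Qed.

Definition law (P : probability T1 R) (f : T1 -> T2)
    (mf : measurable_fun setT f) : probability T2 R :=
  let fm := isMeasurableFun.Build _ _ _ _ _ mf in
  let F : {mfun T1 >-> T2} := HB.pack f fm in distribution P F.

Lemma ge0_integral_law (P : probability T1 R) (f : T1 -> T2)
    (mf : measurable_fun setT f) (h : T2 -> \bar R) :
  measurable_fun setT h -> (forall y, 0 <= h y) ->
  \int[law P mf]_y h y = \int[P]_x h (f x).
Proof.
by move=> mh h0; rewrite (@ge0_integral_pushforward _ _ _ _ _ _ mf).
Qed.

Lemma integral_law (P : probability T1 R) (f : T1 -> T2)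
    (mf : measurable_fun setT f) (h : T2 -> \bar R) :
  measurable_fun setT h -> P.-integrable setT (fun x => h (f x)) ->
  \int[law P mf]_y h y = \int[P]_x h (f x).
Proof.
by move=> mh ih; rewrite (@integral_pushforward _ _ _ _ _ _ mf).
Qed.

Lemma integral_prob_cst (P : probability T1 R) (k : R) :
  \int[P]_x k%:E = k%:E.
Proof.
have P1 := @probability_setT _ _ _ P.
by rewrite integral_cst// -[X in _ * X = _]/(P setT) P1 mule1.
Qed.

End MeasureTools.

Section ProbabilityOfMeasure.
Context {d1 : measure_display} {T1 : measurableType d1} {R : realType}.
Variables (m : {measure set T1 -> \bar R}) (m1 : m setT = 1%E).

(** A name for the set function underlying [m], on which the structure of
probability measure can be declared. *)
Definition prob_fun : set T1 -> \bar R := m.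

HB.instance Definition _ := Measure.copy prob_fun m.
HB.instance Definition _ := Measure_isProbability.Build _ _ _ prob_fun m1.

Definition prob_of_measure : probability T1 R := prob_fun.

End ProbabilityOfMeasure.

(** * The Borel sets of row vectors *)

Section BorelVectors.
Context {R : realType}.
Local Notation E d := (borel_rV R d).

Lemma measurable_open d (U : set 'rV[R]_d) :
  open U -> measurable (U : set (E d)).
Proof. exact: sub_sigma_algebra. Qed.

Lemma measurable_closed d (U : set 'rV[R]_d) :
  closed U -> measurable (U : set (E d)).
Proof.
move=> cU; rewrite -[U]setCK; apply: measurableC.
by apply: measurable_open; exact: closed_openC.
Qed.

Lemma measurable_coord d (i : 'I_d) :
  measurable_fun setT (fun x : E d => (x : 'rV[R]_d) ord0 i).
Proof.
apply: (measurability _ (RGenOInfty.measurableE R)) => _ /= -[_ [r ->] <-].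
rewrite setTI; apply: measurable_open.
by apply: open_comp => [x _|]; [exact: coord_continuous|exact: interval_open].
Qed.

(** The topology has a countable basis of boxes with rational centres, so
coordinatewise measurability is enough. *)
Lemma measurable_fun_row {d0} {T : measurableType d0} d (f : T -> E d) :
  (forall i, measurable_fun setT (fun t => (f t : 'rV[R]_d) ord0 i)) ->
  measurable_fun setT f.
Proof.
move=> mf; apply: (@measurability _ _ _ (E d) setT f (@open 'rV[R]_d) erefl).
move=> _ [U oU <-]; rewrite setTI.
pose box (c : 'rV[rat]_d * nat) : set 'rV[R]_d :=
  [set x | forall i, `|x ord0 i - ratr (c.1 ord0 i)| < c.2.+1%:R^-1].
have -> : f @^-1` U = \bigcup_c
    (if `[< box c `<=` U >] then f @^-1` box c else set0).
  rewrite eqEsubset; split => [t /= Uft|t [c _] /=]; last first.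
    by case: asboolP => // cU /cU.
  have := oU; rewrite openE => /(_ _ Uft) /nbhs_ballP [e /= e0 eU].
  have [n ne] : exists n, n.+1%:R^-1 < e / 2 :> R.
    have e2 : 0 < e / 2 by rewrite divr_gt0.
    have [N _ /(_ N (leqnn N))] := near_infty_natSinv_lt (PosNum e2).
    by exists N.
  have /choice [q hq] : forall i : 'I_d, exists q : rat,
      `|(f t : 'rV[R]_d) ord0 i - ratr q| < n.+1%:R^-1.
    move=> i; set a := (f t : 'rV[R]_d) ord0 i.
    have [|q] := @rat_in_itvoo R (a - n.+1%:R^-1) (a + n.+1%:R^-1).
      by rewrite ltrBlDr -addrA ltrDl addr_gt0 // invr_gt0.
    rewrite in_itv/= => /andP[q1 q2]; exists q.
    by rewrite ltr_distlC q1 q2.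
  exists (\row_i q i, n) => //; rewrite ifT; last first.
    apply/asboolP => x hx; apply: eU.
    rewrite -ball_normE /= /Num.Def.normr /= mx_normrE.
    apply/bigmax_ltP; split => // -[i j] _ /=; rewrite ord1 !mxE.
    have := hx j; have := hq j; rewrite !mxE /= => h1 h2.
    rewrite -[_ - _](subrKA (ratr (q j))) (le_lt_trans (ler_normD _ _)) //.
    rewrite [ltRHS](splitr e) ltrD ?(lt_trans h1 ne)//.
    by rewrite distrC (lt_trans h2 ne).
  by move=> i /=; rewrite mxE; exact: hq.
apply: countable_bigcupT_measurable; first exact: countableP.
move=> c; case: ifP => // _.
have -> : f @^-1` box c = \bigcap_(i in setT)
   ((fun t => (f t : 'rV[R]_d) ord0 i) @^-1`
      [set y | `|y - ratr (c.1 ord0 i)| < c.2.+1%:R^-1]).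
  by rewrite eqEsubset; split => [t ft i _ /=|t ft i]; [exact: ft|exact: ft].
apply: fin_bigcap_measurable; first exact: finite_finset.
move=> i _; rewrite -[X in measurable X]setTI; apply: mf => //.
apply: open_measurable.
by have := @ball_open R R^o (ratr (c.1 ord0 i)) (c.2.+1%:R^-1);
  rewrite -ball_normE /=; under [X in open X]eq_set do rewrite distrC; apply.
Qed.

End BorelVectors.

(** * Independent coordinates and the uniform law *)

Section IndependentCoordinates.
Context {R : realType}.
Local Notation E d := (borel_rV R d).
Local Notation RR := (measurableTypeR R).

Definition row_cons n (z : RR * E n) : E n.+1 :=
  \row_i (if unlift ord0 i is Some j then (z.2 : 'rV[R]_n) ord0 j else z.1).

Lemma measurable_row_cons n : measurable_fun setT (@row_cons n).
Proof.
apply: measurable_fun_row => i; rewrite /row_cons.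
under eq_fun do rewrite mxE.
case: unliftP => [j _|_]; last exact: measurable_fst.
by apply: (measurableT_comp (measurable_coord j)); exact: measurable_snd.
Qed.

(** The product measure on row vectors, built one coordinate at a time from
products of two measures. *)
Fixpoint iid (mu : probability RR R) d : probability (E d) R :=
  if d is n.+1 then law (mu \x iid mu n)%E (@measurable_row_cons n)
  else @dirac _ (E 0) (0 : 'rV[R]_0) R.

Lemma measurable_box d (A : 'I_d -> set RR) : (forall i, measurable (A i)) ->
  measurable ([set x | forall i, A i ((x : 'rV[R]_d) ord0 i)] : set (E d)).
Proof.
move=> mA.
have -> : [set x | forall i, A i ((x : 'rV[R]_d) ord0 i)] =
  \bigcap_(i in setT) ((fun x : E d => (x : 'rV[R]_d) ord0 i) @^-1` A i).
  by rewrite eqEsubset; split => [t ft i _ /=|t ft i]; exact: ft.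
apply: fin_bigcap_measurable; first exact: finite_finset.
move=> i _; rewrite -[X in measurable X]setTI; apply: measurable_coord => //.
exact: mA.
Qed.

Lemma iid_box (mu : probability RR R) d (A : 'I_d -> set RR) :
  (forall i, measurable (A i)) ->
  iid mu d [set x | forall i, A i ((x : 'rV[R]_d) ord0 i)] =
  (\prod_i fine (mu (A i)))%:E.
Proof.
elim: d A => [|n ih] A mA /=.
  rewrite big_ord0 diracE mem_set//= => -[].
  by [].
have -> : @row_cons n @^-1` [set x | forall i, A i (x ord0 i)] =
    A ord0 `*` [set x | forall i, A (lift ord0 i) ((x : 'rV[R]_n) ord0 i)].
  rewrite eqEsubset; split => -[a v] /=.
    move=> H; split => [|i]; first by have := H ord0; rewrite mxE unlift_none.
    by have := H (lift ord0 i); rewrite mxE liftK.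
  by move=> [Aa Av] i; rewrite mxE; case: unliftP => [j ->|->].
rewrite product_measure1E//; last first.
  exact: (@measurable_box _ (fun i => A (lift ord0 i)) (fun i => mA (lift ord0 i))).
rewrite big_ord_recl EFinM; congr (_ * _)%E; last first.
  exact: (ih _ (fun i => mA (lift ord0 i))).
by rewrite fineK //; apply: (fin_num_measure mu); exact: mA.
Qed.

End IndependentCoordinates.

Section UniformInterval.
Context {R : realType}.
Local Notation RR := (measurableTypeR R).

Lemma ltN11R : -1 < 1 :> R. Proof. by lra. Qed.

Definition unif : probability RR R := uniform_prob ltN11R.

Lemma unif_itv_le (c h : R) : 0 <= h ->
  (unif [set u : R | (c - h < u < c + h)%R] <= h%:E)%E.
Proof.
move=> h0; rewrite /unif /uniform_prob.
have -> : [set u : R | c - h < u < c + h] = `]c - h, c + h[%classic.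
  by apply/seteqP; split => u /=; rewrite in_itv.
apply: (@le_trans _ _ (\int[lebesgue_measure]_(x in `](c - h)%R, (c + h)%R[) (2^-1)%:E)%E).
  apply: ge0_le_integral => //=.
  - by move=> x _; rewrite lee_fin uniform_pdf_ge0 // ltN11R.
  - by apply/measurable_EFinP/measurable_funTS; exact: measurable_uniform_pdf.
  - move=> x _; rewrite lee_fin /uniform_pdf; case: ifP => _; last lra.
    by rewrite (_ : 1 - -1 = 2 :> R) //; lra.
rewrite integral_cst//= lebesgue_measure_itv/= lte_fin.
case: ifPn => _; last by rewrite mule0 lee_fin.
by rewrite -EFinD -EFinM lee_fin; lra.
Qed.

Lemma unif_support : unif [set u : R | `|u| <= 1] = 1%E.
Proof.
apply: (integral_uniform_pdf1 ltN11R).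
by move=> u /=; rewrite in_itv/= ler_norml.
Qed.

Lemma measurable_pos : measurable [set u : RR | (0 < u)%R].
Proof.
rewrite (_ : [set u | _] = `]0, +oo[%classic); first exact: measurable_itv.
by apply/seteqP; split => u /=; rewrite in_itv/= andbT.
Qed.

Lemma unif_pos : unif [set u : R | 0 < u] = (2^-1)%:E.
Proof.
apply: (etrans (@integral_uniform_pdf R (-1) 1 [set u : R | 0 < u])).
have -> : [set u : R | 0 < u] `&` `[-1, 1] = `]0, 1]%classic.
  apply/seteqP; split => u /=; rewrite !in_itv/=.
    by move=> [-> /andP[_ ->]].
  by move=> /andP[u0 u1]; rewrite u0 u1; split => //; rewrite andbT; lra.
rewrite (eq_integral (fun=> (2^-1)%:E)); last first.
  move=> x; rewrite inE/= in_itv/= /uniform_pdf => /andP[x0 x1].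
  rewrite ifT; last by rewrite x1 andbT; lra.
  by congr (_%:E); congr (_^-1); lra.
by rewrite integral_cst//= lebesgue_measure_itv/= lte_fin ltr01 oppr0 adde0 mule1.
Qed.

End UniformInterval.

(** * Measurability of Euclidean quantities *)

Section EuclideanMeasurability.
Context {R : realType} {d : nat} {d0 : measure_display} {T : measurableType d0}.
Local Notation E := (borel_rV R d).

Lemma dotv_ge0 (x : 'rV[R]_d) : 0 <= dotv x x.
Proof. by rewrite /dotv sumr_ge0 // => i _; rewrite -expr2 sqr_ge0. Qed.

Lemma sqr_enorm (x : 'rV[R]_d) : enorm x ^+ 2 = dotv x x.
Proof. by rewrite /enorm sqr_sqrtr // dotv_ge0. Qed.

Lemma dotvB_sqr (x y : 'rV[R]_d) :
  dotv (x - y) (x - y) = dotv x x + dotv y y - 2 * dotv x y.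
Proof.
rewrite /dotv mulr_sumr -big_split -sumrB; apply: eq_bigr => i _ /=.
by rewrite !mxE; ring.
Qed.

Lemma measurable_dotv (f g : T -> E) : measurable_fun setT f ->
  measurable_fun setT g ->
  measurable_fun setT (fun t => dotv (f t : 'rV[R]_d) (g t : 'rV[R]_d)).
Proof.
move=> mf mg; apply: measurable_sum => i; apply: measurable_funM.
  exact: measurableT_comp (measurable_coord i) mf.
exact: measurableT_comp (measurable_coord i) mg.
Qed.

Lemma measurable_vecB (f g : T -> E) : measurable_fun setT f ->
  measurable_fun setT g ->
  measurable_fun setT (fun t => ((f t : 'rV[R]_d) - g t : 'rV[R]_d) : E).
Proof.
move=> mf mg; apply: measurable_fun_row => i; under eq_fun do rewrite !mxE.
apply: measurable_funB.
  exact: measurableT_comp (measurable_coord i) mf.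
exact: measurableT_comp (measurable_coord i) mg.
Qed.

End EuclideanMeasurability.

(** * Couplings and their marginals *)

Section Couplings.
Context {d1 d2 : measure_display} {T1 : measurableType d1}
  {T2 : measurableType d2} {R : realType}.
Variables (rho : probability T1 R) (mu : probability T2 R)
  (g : probability (T1 * T2)%type R).
Hypothesis cg : coupling rho mu g.

Lemma coupling_ae1 (P : T1 -> Prop) :
  {ae rho, forall x, P x} -> {ae g, forall z, P z.1}.
Proof.
move=> [N [mN N0 PN]]; exists (fst @^-1` N); split.
- by rewrite -[X in measurable X]setTI; exact: measurable_fst.
- by rewrite -N0 -(cg.1 _ mN).
- by move=> z /= Pz; apply: PN.
Qed.

Lemma coupling_ae2 (P : T2 -> Prop) :
  {ae mu, forall x, P x} -> {ae g, forall z, P z.2}.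
Proof.
move=> [N [mN N0 PN]]; exists (snd @^-1` N); split.
- by rewrite -[X in measurable X]setTI; exact: measurable_snd.
- by rewrite -N0 -(cg.2 _ mN).
- by move=> z /= Pz; apply: PN.
Qed.

Lemma coupling_integral1 (f : T1 -> \bar R) : measurable_fun setT f ->
  (forall x, 0 <= f x)%E -> (\int[g]_z f z.1 = \int[rho]_x f x)%E.
Proof.
move=> mf f0; rewrite -(ge0_integral_law g measurable_fst mf f0).
by apply: eq_measure_integral => A mA _; exact: cg.1.
Qed.

Lemma coupling_integral2 (f : T2 -> \bar R) : measurable_fun setT f ->
  (forall x, 0 <= f x)%E -> (\int[g]_z f z.2 = \int[mu]_x f x)%E.
Proof.
move=> mf f0; rewrite -(ge0_integral_law g measurable_snd mf f0).
by apply: eq_measure_integral => A mA _; exact: cg.2.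
Qed.

End Couplings.

Section GraphPlans.
Context {d1 d2 : measure_display} {T1 : measurableType d1}
  {T2 : measurableType d2} {d3 : measure_display} {T3 : measurableType d3}
  {R : realType}.

Lemma measurable_pair (S : T1 -> T2) (T : T1 -> T3) :
  measurable_fun setT S -> measurable_fun setT T ->
  measurable_fun setT (fun x => (S x, T x)).
Proof. by move=> mS mT; exact/measurable_fun_pairP. Qed.

End GraphPlans.

(** * Uniqueness of the optimal plan carried by a strict maximiser *)

Section OptimalMap.
Context {R : realType} {d : nat}.
Local Notation E := (borel_rV R d).
Variables (rho : probability E R) (T : E -> E) (mT : measurable_fun setT T).
Variables (Z : set E) (mZ : measurable Z) (c : E -> R)
  (mc : measurable_fun setT c) (K : R).
Hypothesis TZ : forall x, Z (T x).

Let aff (x z : E) : R := dotv (x : 'rV[R]_d) (z : 'rV[R]_d) - c z.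
Let sq (x : E) : R := dotv (x : 'rV[R]_d) (x : 'rV[R]_d).

Hypothesis best : {ae rho, forall x, `|sq x - 2 * aff x (T x)| <= K /\
  forall z, Z z -> z <> T x -> aff x z < aff x (T x)}.
Hypothesis bZ : forall z, Z z -> `|sq z - 2 * c z| <= K.

Let mu := law rho mT.
Let gam := law rho (measurable_pair (@measurable_id _ E setT) mT).

(* The truncations keep [A] and [B] between [0] and [2 * K], so that only
nonnegative functions are integrated; they are inactive almost everywhere. *)
Let A (x : E) : R := Num.max 0 (Num.min (2 * K) (sq x - 2 * aff x (T x) + K)).
Let B (z : E) : R := Num.max 0 (Num.min (2 * K) (sq z - 2 * c z + K)).
Let D (p : E * E) : R := Num.max 0 (aff p.1 (T p.1) - aff p.1 p.2).

Let m_aff {d0} {T0 : measurableType d0} (f g : T0 -> E) :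
  measurable_fun setT f -> measurable_fun setT g ->
  measurable_fun setT (fun t => aff (f t) (g t)).
Proof.
move=> mf mg; apply: measurable_funB; first exact: measurable_dotv.
exact: measurableT_comp mc mg.
Qed.

Let m_sq : measurable_fun setT sq.
Proof. exact: (@measurable_dotv _ _ _ _ id id). Qed.

Let mA : measurable_fun setT A.
Proof.
apply: measurable_maxr; first exact: measurable_cst.
apply: measurable_minr; first exact: measurable_cst.
apply: measurable_funD; last exact: measurable_cst.
apply: measurable_funB; first exact: m_sq.
by apply: measurable_funM; [exact: measurable_cst|exact: m_aff].
Qed.

Let mB : measurable_fun setT B.
Proof.
apply: measurable_maxr; first exact: measurable_cst.
apply: measurable_minr; first exact: measurable_cst.
apply: measurable_funD; last exact: measurable_cst.
apply: measurable_funB; first exact: m_sq.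
by apply: measurable_funM; [exact: measurable_cst|exact: mc].
Qed.

Let mD : measurable_fun setT D.
Proof.
apply: measurable_maxr; first exact: measurable_cst.
apply: measurable_funB; apply: m_aff.
- exact: measurable_fst.
- exact: measurableT_comp mT measurable_fst.
- exact: measurable_fst.
- exact: measurable_snd.
Qed.

Let K0 : 0 <= K.
Proof. by apply: le_trans (bZ (TZ 0)). Qed.

Local Open Scope ereal_scope.

Let good (g : probability (E * E)%type R) : coupling rho mu g ->
  {ae g, forall p, [/\ (`|sq p.1 - 2 * aff p.1 (T p.1)| <= K)%R, Z p.2 &
     forall z, Z z -> z <> T p.1 -> (aff p.1 z < aff p.1 (T p.1))%R]}.
Proof.
move=> cg; have h1 := coupling_ae1 cg best.
have Zae : {ae mu, forall z, Z z}.
  exists (~` Z); split; [exact: measurableC| |by []].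
  change (rho (T @^-1` ~` Z) = 0).
  rewrite (_ : T @^-1` (~` Z) = set0) ?measure0//.
  by apply/seteqP; split => x //= /(_ (TZ x)).
have h2 := coupling_ae2 cg Zae.
near=> p.
have [? ?] : (`|sq p.1 - 2 * aff p.1 (T p.1)| <= K)%R /\
  forall z, Z z -> z <> T p.1 -> (aff p.1 z < aff p.1 (T p.1))%R.
  by near: p.
by split => //; near: p.
Unshelve. all: by end_near. Qed.

Let clampE (v : R) : (`|v| <= K)%R ->
  Num.max 0%R (Num.min (2 * K) (v + K))%R = (v + K)%R.
Proof.
rewrite ler_norml => /andP[v1 v2]; rewrite min_r; last by lra.
by rewrite max_r //; lra.
Qed.

(* Up to the constant [2 * K], the quadratic cost is the sum of a function of
the first variable, a function of the second one and the duality gap [2 * D];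
two couplings of the same marginals thus differ only by the integral of
[D]. *)
Let cost_split (g : probability (E * E)%type R) : coupling rho mu g ->
  quadratic_cost g + (2 * K)%:E =
  \int[rho]_x (A x)%:E + \int[mu]_z (B z)%:E + 2%:E * \int[g]_p (D p)%:E.
Proof.
move=> cg.
have mEn : measurable_fun setT
    (fun p : E * E => enorm ((p.1 : 'rV[R]_d) - (p.2 : 'rV[R]_d)) ^+ 2)%R.
  under eq_fun do rewrite sqr_enorm.
  by apply: measurable_dotv; apply: measurable_vecB;
    (exact: measurable_fst || exact: measurable_snd).
have -> : (2 * K)%:E = \int[g]_p (2 * K)%:E.
  by rewrite integral_prob_cst.
rewrite /quadratic_cost -ge0_integralD//; last 3 first.
- by move=> p _; rewrite lee_fin sqr_ge0.
- exact/measurable_EFinP.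
- by move=> p _; rewrite lee_fin mulr_ge0.
rewrite -(coupling_integral1 cg)//; last 2 first.
- exact/measurable_EFinP.
- by move=> x; rewrite lee_fin le_max lexx.
rewrite -(coupling_integral2 cg)//; last 2 first.
- exact/measurable_EFinP.
- by move=> x; rewrite lee_fin le_max lexx.
have D0 p : 0 <= (D p)%:E by rewrite lee_fin le_max lexx.
have A0 p : 0 <= (A p)%:E by rewrite lee_fin le_max lexx.
have B0 p : 0 <= (B p)%:E by rewrite lee_fin le_max lexx.
have mA1 : measurable_fun setT (fun p : E * E => (A p.1)%:E).
  by apply/measurable_EFinP; exact: measurableT_comp mA measurable_fst.
have mB2 : measurable_fun setT (fun p : E * E => (B p.2)%:E).
  by apply/measurable_EFinP; exact: measurableT_comp mB measurable_snd.
have mDE : measurable_fun setT (fun p : E * E => (D p)%:E).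
  exact/measurable_EFinP.
have mD2 : measurable_fun setT (fun p : E * E => 2%:E * (D p)%:E).
  exact: measurable_funeM.
have D20 p : 0 <= 2%:E * (D p)%:E by rewrite mule_ge0.
have mAB : measurable_fun setT (fun p : E * E => (A p.1)%:E + (B p.2)%:E).
  exact: emeasurable_funD.
have AB0 (p : E * E) : 0 <= (A p.1)%:E + (B p.2)%:E by rewrite adde_ge0.
rewrite -(ge0_integralZl g measurableT mDE (fun p _ => D0 p)) ?lee_fin//.
rewrite -(ge0_integralD g measurableT (fun p _ => A0 p.1) mA1 (fun p _ => B0 p.2) mB2).
rewrite -(ge0_integralD g measurableT (fun p _ => AB0 p) mAB (fun p _ => D20 p) mD2).
apply: ge0_ae_eq_integral => //.
- by apply: emeasurable_funD => //; exact/measurable_EFinP.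
- exact: emeasurable_funD.
- by move=> x _; rewrite -EFinD lee_fin addr_ge0 ?sqr_ge0 ?mulr_ge0.
- by move=> x _; rewrite !adde_ge0 // mule_ge0.
have gd := good cg.
near=> p => _.
have [h1 h2 h3] : [/\ (`|sq p.1 - 2 * aff p.1 (T p.1)| <= K)%R, Z p.2 &
     forall z, Z z -> z <> T p.1 -> (aff p.1 z < aff p.1 (T p.1))%R].
  by near: p.
rewrite /A /B clampE ?clampE//; last exact: bZ.
have -> : D p = (aff p.1 (T p.1) - aff p.1 p.2)%R.
  rewrite /D max_r // subr_ge0.
  by have [->//|/eqP ne] := eqVneq p.2 (T p.1); exact/ltW/h3.
rewrite -EFinM -!EFinD; congr (_%:E).
rewrite sqr_enorm dotvB_sqr /sq /aff.
set dd := dotv p.1 p.2.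
by ring.
Unshelve. all: by end_near. Qed.

Let finA : \int[rho]_x (A x)%:E \is a fin_num.
Proof.
rewrite ge0_fin_numE; last first.
  by apply: integral_ge0 => x _; rewrite lee_fin le_max lexx.
apply: (@le_lt_trans _ _ (\int[rho]_x (2 * K)%:E)).
  apply: le_integral_nonmeas => x; rewrite lee_fin ge_max mulr_ge0//=.
  by rewrite ge_min lexx.
by rewrite integral_prob_cst ltry.
Qed.

Let finB : \int[mu]_x (B x)%:E \is a fin_num.
Proof.
rewrite ge0_fin_numE; last first.
  by apply: integral_ge0 => x _; rewrite lee_fin le_max lexx.
apply: (@le_lt_trans _ _ (\int[mu]_x (2 * K)%:E)).
  apply: le_integral_nonmeas => x; rewrite lee_fin ge_max mulr_ge0//=.
  by rewrite ge_min lexx.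
by rewrite integral_prob_cst ltry.
Qed.

Let gam_coupling : coupling rho mu gam.
Proof. by []. Qed.

Let D_gam : \int[gam]_p (D p)%:E = 0.
Proof.
rewrite ge0_integral_law; [|exact/measurable_EFinP|]; last first.
  by move=> p; rewrite lee_fin le_max lexx.
rewrite (eq_integral (cst 0)) ?integral0// => x _.
by rewrite /D /= subrr maxxx.
Qed.

(** The duality gap [D] vanishes on the graph of [T], so the graph plan is optimal.
It is positive at almost every point off the graph because the maximum is
strict, so every optimal plan is carried by the graph, and it is then determined
by its first marginal. *)
Lemma unique_optimal_graph : unique_optimal_plan rho mu gam.
Proof.
have opt g : coupling rho mu g -> quadratic_cost gam <= quadratic_cost g.
  move=> cg; rewrite -(@leeD2rE _ (2 * K)%:E)//.
  rewrite (cost_split cg) (cost_split gam_coupling) D_gam mule0 adde0.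
  rewrite leeDl// mule_ge0// integral_ge0// => p _.
  by rewrite lee_fin le_max lexx.
split; first by split.
move=> g [cg og] S mS.
have D_g : \int[g]_p (D p)%:E = 0.
  have := leeD2r (2 * K)%:E (og _ gam_coupling).
  rewrite (cost_split cg) (cost_split gam_coupling) D_gam mule0 adde0.
  have fAB : \int[rho]_x (A x)%:E + \int[mu]_z (B z)%:E \is a fin_num.
    by rewrite fin_numD finA finB.
  rewrite -[leRHS]adde0 (leeD2lE _ _ fAB) pmule_rle0 ?lte_fin// => h.
  apply/eqP; rewrite eq_le h /=.
  by apply: integral_ge0 => p _; rewrite lee_fin le_max lexx.
have D0 : ae_eq g setT (fun p => (D p)%:E) (cst 0).
  apply/ae_eq_integral_abs => //; first exact/measurable_EFinP.
  rewrite -[RHS]D_g; apply: eq_integral => p _.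
  by rewrite gee0_abs // lee_fin le_max lexx.
have mG : measurable [set p : E * E | S (p.1, T p.1)].
  rewrite -[X in measurable X]setTI.
  apply: (measurable_pair measurable_fst (measurableT_comp mT measurable_fst)) => //.
have graph : {ae g, forall p, p.2 = T p.1}.
  have gd := good cg.
  near=> p.
  have [h1 h2 h3] : [/\ (`|sq p.1 - 2 * aff p.1 (T p.1)| <= K)%R, Z p.2 &
     forall z, Z z -> z <> T p.1 -> (aff p.1 z < aff p.1 (T p.1))%R].
    by near: p.
  have /eqP : (D p)%:E = 0 by near: p; apply: filterS D0 => p; exact.
  rewrite eqe /D => /eqP D00.
  apply: contrapT => /(h3 _ h2); rewrite -subr_gt0 => lt.
  by move: D00; rewrite max_r ?(ltW lt)// => e; rewrite e ltxx in lt.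
transitivity (g [set p : E * E | S (p.1, T p.1)]).
  have [N [mN N0 PN]] := graph.
  apply/eqP; rewrite eq_le; apply/andP; split.
    apply: (@le_trans _ _ (g ([set p : E * E | S (p.1, T p.1)] `|` N))).
      apply: le_measure; rewrite ?inE//; first exact: measurableU.
      move=> [x z] /= Sxz; have [e|ne] := EM (z = T x); first by left; rewrite -e.
      by right; apply: PN.
    by apply: (le_trans (measureU2 _ mG mN)); rewrite [X in _ + X]N0 adde0.
  apply: (@le_trans _ _ (g (S `|` N))).
    apply: le_measure; rewrite ?inE//; first exact: measurableU.
    move=> [x z] /= Sxz; have [e|ne] := EM (z = T x); first by left; rewrite e.
    by right; apply: PN.
  by apply: (le_trans (measureU2 _ mS mN)); rewrite [X in _ + X]N0 adde0.
have mG' : measurable [set x : E | S (x, T x)].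
  rewrite -[X in measurable X]setTI.
  exact: (measurable_pair (@measurable_id _ E setT) mT).
by have := cg.1 _ mG'; rewrite /pushforward => ->.
Unshelve. all: by end_near. Qed.

End OptimalMap.

(** * Convex functions are bounded on boxes *)

Section ConvexFunctions.
Context {R : realType} {d : nat}.
Local Notation V := 'rV[R]_d.
Implicit Types f : V -> R.

Lemma convex_functionP f : convex_function setT f <->
  forall t x y, 0 <= t -> t <= 1 ->
    f (t *: x + (1 - t) *: y) <= t * f x + (1 - t) * f y.
Proof.
split => [cf t x y t0 t1|cf t x y _ _].
  by apply: (cf (Itv01 t0 t1)); rewrite inE.
by apply: (cf t%:inum x y).
Qed.

Lemma convex_mid f x y : convex_function setT f ->
  f x <= (f (2 *: y) + f (2 *: (x - y))) / 2.
Proof.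
move/convex_functionP => /(_ 2^-1 (2 *: y) (2 *: (x - y))).
rewrite !scalerA (_ : 1 - 2^-1 = 2^-1 :> R); last by lra.
by rewrite mulVf// !scale1r subrKC => h; have := h _ _; lra.
Qed.

Lemma convex_axis_ub f (B : R) i : convex_function setT f ->
  forall s, `|s| <= B -> f (s *: delta_mx ord0 i) <=
    Num.max (f (B *: delta_mx ord0 i)) (f (- B *: delta_mx ord0 i)).
Proof.
move=> /convex_functionP cf s; rewrite ler_norml => /andP[s1 s2].
have [B0|B0] := eqVneq B 0.
  have -> : s = B by lra.
  by rewrite le_max lexx.
have Bp : 0 < B by rewrite lt_neqAle eq_sym B0; lra.
have t0 : 0 <= (s + B) / (2 * B) by rewrite divr_ge0 ?mulr_ge0 //; lra.
have t1 : (s + B) / (2 * B) <= 1 by rewrite ler_pdivrMr ?mulr_gt0//; lra.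
have := cf _ (B *: delta_mx ord0 i) (- B *: delta_mx ord0 i) t0 t1.
set t := (s + B) / (2 * B).
rewrite !scalerA -scalerDl (_ : t * B + (1 - t) * - B = s); last first.
  by rewrite /t; field.
move/le_trans; apply.
set M := Num.max _ _.
rewrite [leRHS](_ : _ = t * M + (1 - t) * M); last by ring.
by apply: lerD; apply: ler_wpM2l; rewrite ?subr_ge0// le_max lexx ?orbT.
Qed.

(** A point with [k.+1] free coordinates is the midpoint of a point with [k] free
coordinates and of a point on an axis, both in the box of double size. *)
Lemma convex_box_ub f (k : nat) : convex_function setT f -> forall B : R,
  exists M, forall x : V, (forall i, `|x ord0 i| <= B) ->
    (forall i : 'I_d, (k <= i)%N -> x ord0 i = 0) -> f x <= M.
Proof.
move=> cf; elim: k => [|k ih] B.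
  exists (f 0) => x _ x0; rewrite (_ : x = 0)//.
  by apply/rowP => i; rewrite mxE x0.
have [M hM] := ih (2 * B).
have [kd|dk] := ltnP k d; last first.
  exists M => x xB x0; apply: hM => i.
    by rewrite (le_trans (xB i))// ler_peMl ?(le_trans _ (xB i))//; lra.
  by move=> ki; have := leq_trans dk ki; rewrite leqNgt ltn_ord.
pose i := Ordinal kd; pose e : V := delta_mx ord0 i.
exists ((Num.max (f (2 * B *: e)) (f (- (2 * B) *: e)) + M) / 2) => x xB x0.
apply: le_trans (convex_mid x (x ord0 i *: e) cf) _.
rewrite ler_pM2r ?invr_gt0//; apply: lerD.
  rewrite scalerA; apply: convex_axis_ub => //.
  by rewrite normrM ger0_norm// ler_pM2l.
apply: hM => j.
  rewrite !mxE eqxx/= normrM ger0_norm// ler_pM2l//.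
  case: eqP => [->|_]; last by rewrite mulr0 subr0.
  by rewrite mulr1 subrr normr0 (le_trans _ (xB i)).
move=> kj; rewrite !mxE eqxx/=; case: eqP => [->|/eqP ne].
  by rewrite mulr1 subrr mulr0.
rewrite mulr0 subr0 x0 ?mulr0// ltn_neqAle kj andbT.
by apply: contraNneq ne => kji; apply/eqP/val_inj.
Qed.

(** Since [f 0 <= (f x + f (- x)) / 2], an upper bound on a symmetric box gives a
lower bound. *)
Lemma convex_box_lb f (B : R) : convex_function setT f ->
  exists K, forall x : V, (forall i, `|x ord0 i| <= B) -> - K <= f x.
Proof.
move=> cf; have [M hM] := @convex_box_ub f d cf B.
exists (M - 2 * f 0) => x xB.
have h : f (- x) <= M.
  apply: hM => i; first by rewrite mxE normrN.
  by rewrite leqNgt ltn_ord.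
have := convex_functionP f; case=> /(_ cf 2^-1 x (- x)) + _.
rewrite (_ : 1 - 2^-1 = 2^-1 :> R); last by lra.
by rewrite scalerN subrr => h0; have := h0 _ _; lra.
Qed.

End ConvexFunctions.

(** * The Euclidean inner product *)

Section DotProduct.
Context {R : realType} {d : nat}.
Local Notation V := 'rV[R]_d.
Implicit Types x y z : V.

Lemma dotvDl x y z : dotv (x + y) z = dotv x z + dotv y z.
Proof.
by rewrite /dotv -big_split; apply: eq_bigr => i _; rewrite mxE mulrDl.
Qed.

Lemma dotvZl a x z : dotv (a *: x) z = a * dotv x z.
Proof.
by rewrite /dotv mulr_sumr; apply: eq_bigr => i _; rewrite mxE mulrA.
Qed.

Lemma dotvC x y : dotv x y = dotv y x.
Proof. by apply: eq_bigr => i _; rewrite mulrC. Qed.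

Lemma dotv0l z : dotv 0 z = 0.
Proof. by rewrite -[0](scale0r 0) dotvZl mul0r. Qed.

Lemma dotvNl x z : dotv (- x) z = - dotv x z.
Proof. by rewrite -scaleN1r dotvZl mulN1r. Qed.

Lemma dotvBl x y z : dotv (x - y) z = dotv x z - dotv y z.
Proof. by rewrite dotvDl dotvNl. Qed.

Lemma dotvBr x y z : dotv z (x - y) = dotv z x - dotv z y.
Proof. by rewrite dotvC dotvBl !(dotvC z). Qed.

Lemma dotv_delta i x : dotv (delta_mx ord0 i) x = x ord0 i.
Proof.
rewrite /dotv (bigD1 i)//= mxE !eqxx mul1r big1 ?addr0// => j ji.
by rewrite mxE eqxx (negbTE ji) mul0r.
Qed.

Lemma dotv_bound (a b : R) x y : (forall i, `|x ord0 i| <= a) ->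
  (forall i, `|y ord0 i| <= b) -> `|dotv x y| <= d%:R * (a * b).
Proof.
move=> xa yb; apply: le_trans (ler_norm_sum _ _ _) _.
rewrite [leRHS](_ : _ = \sum_(i < d) a * b); last first.
  by rewrite sumr_const card_ord mulr_natl.
by apply: ler_sum => i _; rewrite normrM ler_pM.
Qed.

Lemma coord_le_norm x i : `|x ord0 i| <= `|x|.
Proof.
rewrite [leRHS]/Num.Def.normr /= mx_normrE.
by apply/bigmax_geP; right; exists (ord0, i).
Qed.

Lemma coord_bounded x : exists B : R, forall i, `|x ord0 i| <= B.
Proof. by exists `|x|; exact: coord_le_norm. Qed.

Lemma derive_affine (w : V) (c : R) (v x : V) :
  'D_v ((fun u => dotv u w - c) : V -> R^o) x = dotv v w.
Proof.
apply: cvg_lim => //; apply: cvg_near_cst.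
near=> h.
have h0 : h != 0 by near: h; exact: nbhs_dnbhs_neq.
rewrite /= !dotvDl dotvZl /GRing.scale /=.
by rewrite [X in _ * X](_ : _ = h * dotv v w) ?mulKf//; ring.
Unshelve. all: by end_near. Qed.

End DotProduct.

(** * Double conjugation of a maximum of affine functions *)

Section DualPotential.
Context {R : realType} {d : nat}.
Local Notation V := 'rV[R]_d.
Variables (X Y : set V) (KX KY : R).
Hypothesis bX : forall x, X x -> forall i, `|x ord0 i| <= KX.
Hypothesis bY : forall y, Y y -> forall i, `|y ord0 i| <= KY.
Variables (x1 : V) (Xx1 : X x1).
Variables (zs : seq V) (z0 : V) (zs0 : z0 \in zs).
Hypothesis zsY : forall z, z \in zs -> Y z.
Variable c : V -> R.

Let aff x z := dotv x z - c z.

Definition max_affine (x : V) : R := \big[Num.max/aff x z0]_(z <- zs) aff x z.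

Lemma max_affine_ge x z : z \in zs -> aff x z <= max_affine x.
Proof. by move=> zin; exact: le_bigmax_seq. Qed.

Lemma max_affine_eq x z : z \in zs -> (forall w, w \in zs -> aff x w <= aff x z) ->
  max_affine x = aff x z.
Proof.
move=> zin zmax; apply/eqP; rewrite eq_le max_affine_ge// andbT.
by rewrite /max_affine big_seq; apply: bigmax_le => [|w win]; exact: zmax.
Qed.

(** The Legendre transform restricted to [A]. The real value stands for the
supremum once this is known to be finite, which is [dual_supE]. *)
Definition dual_sup (A : set V) (f : V -> R) (y : V) : R :=
  fine (ereal_sup [set (dotv x y - f x)%:E | x in A]).

Definition dual_potential : V -> R := dual_sup X max_affine.
Definition bidual_potential : V -> R := dual_sup Y dual_potential.

Lemma dual_supE (A : set V) f y (M : R) a : A a ->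
  (forall x, A x -> dotv x y - f x <= M) ->
  (dual_sup A f y)%:E = ereal_sup [set (dotv x y - f x)%:E | x in A].
Proof.
move=> Aa bM; rewrite /dual_sup fineK//.
rewrite fin_numElt; apply/andP; split.
  apply: (@lt_le_trans _ _ (dotv a y - f a)%:E); first exact: ltNyr.
  by apply: ereal_sup_ubound; exists a.
apply: (@le_lt_trans _ _ M%:E); last exact: ltry.
by apply: ge_ereal_sup => _ [x Ax <-]; rewrite lee_fin; exact: bM.
Qed.

Lemma dual_potentialE y : (dual_potential y)%:E =
  ereal_sup [set (dotv x y - max_affine x)%:E | x in X].
Proof.
have [B yB] := coord_bounded (y - z0).
apply: (@dual_supE _ _ _ (d%:R * (KX * B) + c z0) x1 Xx1) => x Xx.
have := max_affine_ge x zs0; rewrite /aff.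
have := dotv_bound (bX Xx) yB; rewrite dotvBr ler_norml => /andP[_ h1] h2.
by lra.
Qed.

Lemma dual_potential_ge x y : X x -> dotv x y - max_affine x <= dual_potential y.
Proof.
move=> Xx; rewrite -lee_fin dual_potentialE.
by apply: ereal_sup_ubound; exists x.
Qed.

Lemma bidual_potentialE x : (bidual_potential x)%:E =
  ereal_sup [set (dotv x y - dual_potential y)%:E | y in Y].
Proof.
have [B xB] := coord_bounded (x - x1).
rewrite (@dual_supE _ _ _ (d%:R * (B * KY) + max_affine x1) z0 (zsY zs0)).
  by congr ereal_sup; apply/seteqP; split => _ [y Yy <-]; exists y => //;
    rewrite dotvC.
move=> y Yy; have := dual_potential_ge y Xx1.
have := dotv_bound xB (bY Yy); rewrite dotvBl ler_norml => /andP[_ h1] h2.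
by rewrite dotvC; lra.
Qed.

Lemma bidual_ge x y : Y y -> dotv x y - dual_potential y <= bidual_potential x.
Proof.
move=> Yy; rewrite -lee_fin bidual_potentialE.
by apply: ereal_sup_ubound; exists y.
Qed.

Lemma dual_potential_atom z : z \in zs -> dual_potential z <= c z.
Proof.
move=> zin; rewrite -lee_fin dual_potentialE; apply: ge_ereal_sup => _ [x Xx <-].
by rewrite lee_fin; have := max_affine_ge x zin; rewrite /aff; lra.
Qed.

Lemma bidual_ge_affine x z : z \in zs -> aff x z <= bidual_potential x.
Proof.
move=> zin; have := bidual_ge x (zsY zin); have := dual_potential_atom zin.
by rewrite /aff; lra.
Qed.

(** Double conjugation gives the maximum of affine functions the form required of a
Brenier potential. The slopes belong to [Y], so this does not lower it anywhere;
and it does not raise it on [X]. *)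
Lemma bidual_eq x : X x -> bidual_potential x = max_affine x.
Proof.
move=> Xx; apply/eqP; rewrite eq_le; apply/andP; split.
  rewrite -lee_fin bidual_potentialE; apply: ge_ereal_sup => _ [y Yy <-].
  by rewrite lee_fin; have := dual_potential_ge y Xx; lra.
by rewrite /max_affine big_seq; apply: bigmax_le => [|z zin]; exact: bidual_ge_affine.
Qed.

Lemma dual_potentialE2 y : (dual_potential y)%:E =
  ereal_sup [set (dotv x y - bidual_potential x)%:E | x in X].
Proof.
rewrite dual_potentialE; congr ereal_sup.
by apply/seteqP; split => _ [x Xx <-]; exists x => //; rewrite bidual_eq.
Qed.

Lemma conjugate_bidual_atom z : z \in zs ->
  (conjugate bidual_potential z <= (c z)%:E)%E.
Proof.
move=> zin; apply: ge_ereal_sup => _ [x _ <-].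
by rewrite lee_fin; have := bidual_ge_affine x zin; rewrite /aff; lra.
Qed.

Lemma bidual_convex : convex_function setT bidual_potential.
Proof.
apply/convex_functionP => t x y t0 t1.
rewrite -lee_fin bidual_potentialE; apply: ge_ereal_sup => _ [z Yz <-].
rewrite lee_fin dotvDl !dotvZl.
have := ler_wpM2l t0 (bidual_ge x Yz).
have t10 : 0 <= 1 - t by rewrite subr_ge0.
have := ler_wpM2l t10 (bidual_ge y Yz).
by lra.
Qed.

(** By continuity the strict maximiser at [x] stays the maximiser nearby, so the
potential is affine around [x]. *)
Lemma grad_bidual x z : X° x -> z \in zs ->
  (forall w, w \in zs -> w <> z -> aff x w < aff x z) ->
  grad bidual_potential x = z.
Proof.
move=> Xx zin best; apply/rowP => i; rewrite mxE.
have aff_cont w : aff u w @[u --> x] --> aff x w.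
  have dot_cont : dotv u w @[u --> x] --> dotv x w.
    have h (j : 'I_d) : (fun u : V => u ord0 j * w ord0 j) @ x -->
        x ord0 j * w ord0 j.
      exact: (cvgM (@coord_continuous R 1 d ord0 j x) (cvg_cst (w ord0 j))).
    exact: (@cvg_big R^o _ _ 0 xpredT (@add_continuous R^o) V (nbhs x)
      (index_enum _) (fun j (u : V) => u ord0 j * w ord0 j)
      (fun j => x ord0 j * w ord0 j) (nbhs_filter x) (fun j _ => h j)).
  exact: (cvgB dot_cont (cvg_cst (c w))).
have near_best : \forall u \near x, forall w, w \in zs -> aff u w <= aff u z.
  have : forall s : seq V, {subset s <= zs} ->
      \forall u \near x, forall w, w \in s -> aff u w <= aff u z.
    elim=> [|w s ih] sub; first by near=> u => w; rewrite in_nil.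
    have h1 := ih (fun v vs => sub v (@mem_behead _ (w :: s) v vs)).
    have h2 : \forall u \near x, aff u w <= aff u z.
      have [->|/eqP wz] := eqVneq w z; first by near=> u.
      have lt := best w (sub w (mem_head _ _)) wz.
      have gap0 : 0 < aff x z - aff x w by rewrite subr_gt0.
      have gt := cvgr_gt _ (cvgB (aff_cont z) (aff_cont w)) _ gap0.
      by near=> u; rewrite -subr_ge0 ltW//; near: u; exact: gt.
    near=> u => v; rewrite in_cons => /orP[/eqP->|vs]; first by near: u.
    by move: v vs; near: u.
  exact.
have nX : \forall u \near x, X u by exact: Xx.
rewrite (@near_eq_derive _ _ _ _ (fun u => dotv u z - c z)).
  by rewrite derive_affine dotv_delta.
near=> u; rewrite bidual_eq; last by near: u.
by apply: max_affine_eq => //; near: u.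
Unshelve. all: by end_near. Qed.

End DualPotential.

(** * Brenier potentials with finitely many slopes *)

Section IntegralBounds.
Context {d0 : measure_display} {T0 : measurableType d0} {R : realType}.
Variable P : probability T0 R.
Local Open Scope ereal_scope.

(** Changing [g] to [+oo] on a null set makes the bound hold everywhere and keeps
it measurable. *)
Lemma le_integral_ae_ub (f : T0 -> \bar R) (g : T0 -> R) :
  measurable_fun setT g -> {ae P, forall x, f x <= (g x)%:E} ->
  \int[P]_x f x <= \int[P]_x (g x)%:E.
Proof.
move=> mg [N [mN N0 fN]].
pose h x : \bar R := if x \in N then +oo else (g x)%:E.
have mh : measurable_fun setT h.
  apply: measurable_fun_ifT; [|exact: measurable_cst|exact/measurable_EFinP].
  apply: (measurable_fun_bool true); rewrite setTI.
  by rewrite (_ : _ @^-1` _ = N)//; apply/seteqP; split => x; [move/set_mem|move/mem_set].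
have -> : \int[P]_x (g x)%:E = \int[P]_x h x.
  apply: ae_eq_integral => //; first exact/measurable_EFinP.
  exists N; split => // x /=; rewrite /h; case: ifPn => [/set_mem//|_] H.
  by exfalso; apply: H.
apply: le_integral_nonmeas => x; rewrite /h; case: ifPn; first by rewrite leey.
by rewrite notin_setE => Nx; apply: contrapT => H; apply: Nx; apply: fN.
Qed.

Lemma le_integral_ae_lb (f : T0 -> \bar R) (g : T0 -> R) :
  measurable_fun setT g -> {ae P, forall x, (g x)%:E <= f x} ->
  \int[P]_x (g x)%:E <= \int[P]_x f x.
Proof.
move=> mg [N [mN N0 fN]].
pose h x : \bar R := if x \in N then -oo else (g x)%:E.
have mh : measurable_fun setT h.
  apply: measurable_fun_ifT; [|exact: measurable_cst|exact/measurable_EFinP].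
  apply: (measurable_fun_bool true); rewrite setTI.
  by rewrite (_ : _ @^-1` _ = N)//; apply/seteqP; split => x; [move/set_mem|move/mem_set].
have -> : \int[P]_x (g x)%:E = \int[P]_x h x.
  apply: ae_eq_integral => //; first exact/measurable_EFinP.
  exists N; split => // x /=; rewrite /h; case: ifPn => [/set_mem//|_] H.
  by exfalso; apply: H.
apply: le_integral_nonmeas => x; rewrite /h; case: ifPn; first by rewrite leNye.
by rewrite notin_setE => Nx; apply: contrapT => H; apply: Nx; apply: fN.
Qed.

Lemma integrable_ae_bounded (g : T0 -> R) (M : R) :
  measurable_fun setT g -> {ae P, forall x, (`|g x| <= M)%R} ->
  P.-integrable setT (EFin \o g).
Proof.
move=> mg gM; apply/integrableP; split; first exact/measurable_EFinP.
apply: (@le_lt_trans _ _ (\int[P]_x M%:E)).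
  apply: le_integral_ae_ub; first exact: measurable_cst.
  by apply: filterS gM => x /=; rewrite lee_fin.
by rewrite integral_prob_cst ltry.
Qed.

End IntegralBounds.

Section FiniteSets.
Context {R : realType} {d : nat}.
Local Notation E := (borel_rV R d).
Local Notation V := 'rV[R]_d.

Lemma measurable_point (w : V) : measurable ([set w] : set E).
Proof. by apply: measurable_closed; exact: (accessible_closed_set1 (hausdorff_accessible (@norm_hausdorff _ _))). Qed.

Lemma measurable_seq (s : seq V) : measurable ([set` s] : set E).
Proof.
elim: s => [|w s ih].
  by rewrite (_ : [set` _] = set0) //; apply/seteqP; split.
rewrite (_ : [set` w :: s] = [set w] `|` [set` s]).
  by apply: measurableU => //; exact: measurable_point.
apply/seteqP; split => z /=; rewrite in_cons; first by case/orP => [/eqP|]; [left|right].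
by case=> [->|->]; rewrite ?eqxx ?orbT.
Qed.

(** The conjugate of a convex function is only ever integrated against a measure
with finitely many atoms, where it can be replaced by a measurable function. *)
Lemma measurable_fun_on_seq (s : seq V) (G : V -> R) :
  exists2 G' : E -> R, measurable_fun setT G' & forall z, z \in s -> G' z = G z.
Proof.
elim: s => [|w s [G' mG' hG']].
  by exists (fun=> 0); first exact: measurable_cst.
exists (fun z => if (z : V) == w then G w else G' z).
  apply: measurable_fun_ifT; [|exact: measurable_cst|exact: mG'].
  apply: (measurable_fun_bool true); rewrite setTI.
  rewrite (_ : _ @^-1` _ = [set w]); first exact: measurable_point.
  by apply/seteqP; split => z /=; [move/eqP|move=> ->; rewrite eqxx].
by move=> z; rewrite in_cons; case: eqP => [-> _|_ /= /hG'].
Qed.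

Lemma seq_bounded (s : seq V) (G : V -> R) :
  exists M, forall z, z \in s -> `|G z| <= M.
Proof.
elim: s => [|w s [M hM]]; first by exists 0.
exists (Num.max `|G w| M) => z; rewrite in_cons le_max => /orP[/eqP->|/hM ->].
  by rewrite lexx.
by rewrite orbT.
Qed.

End FiniteSets.

Section BrenierPotential.
Context {R : realType} {d : nat}.
Local Notation E := (borel_rV R d).
Local Notation V := 'rV[R]_d.
Variables (rho : probability E R) (T : E -> E) (mT : measurable_fun setT T).
Variables (X Y : set V) (KX KY : R).
Hypothesis bX : forall x, X x -> forall i, `|x ord0 i| <= KX.
Hypothesis bY : forall y, Y y -> forall i, `|y ord0 i| <= KY.
Variables (x1 : V) (Xx1 : X x1).
Variables (zs : seq V) (z0 : V) (zs0 : z0 \in zs).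
Hypothesis zsY : forall z, z \in zs -> Y z.
Variables (c : V -> R) (mc : measurable_fun setT (c : E -> R)).
Hypothesis Tzs : forall x, T x \in zs.
Hypothesis best : {ae rho, forall x : E, X x /\
  forall z, z \in zs -> z <> T x -> dotv x z - c z < dotv (x : V) (T x : V) - c (T x)}.

Let mu := law rho mT.
Let phi := bidual_potential X Y zs z0 c.

Let ae_atom : {ae mu, forall z : E, (z : V) \in zs}.
Proof.
exists (~` [set` zs]); split => //; first by apply: measurableC; exact: measurable_seq.
change (rho (T @^-1` ~` [set` zs]) = 0%E).
rewrite (_ : _ @^-1` _ = set0) ?measure0//.
by apply/seteqP; split => x //=; rewrite Tzs.
Qed.

Let m_dotT : measurable_fun setT (fun x : E => dotv (x : V) (T x : V)).
Proof. exact: measurable_dotv. Qed.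

Let dot_bound : {ae rho, forall x : E,
  `|dotv (x : V) (T x : V)| <= d%:R * (KX * KY)}.
Proof.
apply: filterS best => x [Xx _]; apply: dotv_bound; first exact: bX.
by apply: bY; exact/zsY/Tzs.
Qed.

Let split_dot (G : E -> R) : measurable_fun setT G ->
  (\int[rho]_x (dotv (x : V) (T x : V) - G (T x))%:E + \int[mu]_z (G z)%:E =
   \int[rho]_x (dotv (x : V) (T x : V))%:E)%E.
Proof.
move=> mG; have [M hM] := seq_bounded zs G.
have mGT : measurable_fun setT (fun x => G (T x)) by exact: measurableT_comp mG mT.
have iGT : rho.-integrable setT (EFin \o (fun x => G (T x))).
  by apply: (@integrable_ae_bounded _ _ _ _ _ M) => //; apply: nearW => x; exact: hM.
have iD : rho.-integrable setT (EFin \o (fun x : E => dotv (x : V) (T x : V))).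
  exact: (integrable_ae_bounded m_dotT dot_bound).
have mGE : measurable_fun setT (fun z => (G z)%:E) by exact/measurable_EFinP.
rewrite (integral_law mT mGE iGT) -integralD_EFin//; last first.
  have -> : EFin \o (fun x : E => dotv (x : V) (T x : V) - G (T x)) =
    (fun x : E => (dotv (x : V) (T x : V))%:E - (G (T x))%:E)%E by [].
  exact: integrableB.
by apply: eq_integral => x _; rewrite -EFinD subrK.
Qed.

(** Every competitor pays at least the integral of the inner product of [x] and
[T x], by the inequality between a function and its conjugate. The double
conjugate attains this value, because its conjugate is at most [c] at the
atoms. *)
Lemma bidual_brenier : brenier_potential X Y rho mu phi.
Proof.
split.
- exact: (bidual_convex bX bY Xx1 zs0 zsY).
- move=> psi cpsi.
  apply: (@le_trans _ _ (\int[rho]_x (dotv (x : V) (T x : V))%:E)%E).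
    rewrite -(split_dot mc); apply: leeD; apply: le_integral_ae_ub => //.
    + exact: measurable_funB m_dotT (measurableT_comp mc mT).
    + apply: filterS best => x [Xx bx].
      rewrite lee_fin /phi (bidual_eq bX bY Xx1 zs0 zsY)//.
      rewrite (@max_affine_eq _ _ _ _ zs0 _ x (T x))//.
      move=> w win; have [->//|/eqP ne] := eqVneq w (T x).
      exact/ltW/bx.
    + apply: filterS ae_atom => z zin.
      exact: (conjugate_bidual_atom bX bY Xx1 zs0 zsY).
  have [B hB] := convex_box_lb KX cpsi.
  (* The conjugate of a competitor may be infinite at an atom. Since the
  competitor is at least [- B] on [X], the finite level [N] can replace it
  there without breaking the inequality. *)
  pose N := B + d%:R * (KX * KY).
  pose G z := if conjugate psi z is r%:E then r else N.
  have conj_gt z : (conjugate psi z != -oo)%E.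
    rewrite -ltNye; apply: (@lt_le_trans _ _ (- psi 0)%:E); first exact: ltNyr.
    by apply: ereal_sup_ubound; exists 0 => //; rewrite dotv0l add0r.
  have [G' mG' hG'] := measurable_fun_on_seq zs G.
  rewrite -(split_dot mG'); apply: leeD; apply: le_integral_ae_lb => //.
  + exact: measurable_funB m_dotT (measurableT_comp mG' mT).
  + apply: filterS best => x [Xx _]; rewrite lee_fin hG' // /G.
    case e : (conjugate psi (T x)) => [r||].
    * rewrite lerBlDr -lerBlDl -lee_fin -e.
      by apply: ereal_sup_ubound; exists x.
    * apply: le_trans (hB x (bX Xx)); rewrite /N.
      have := dotv_bound (bX Xx) (bY (zsY (Tzs x))).
      by rewrite ler_norml => /andP[_]; lra.
    * by have := conj_gt (T x); rewrite e.
  + apply: filterS ae_atom => z zin; rewrite hG' // /G.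
    case e : (conjugate psi z) => [r||]//; first by rewrite leey.
    by have := conj_gt z; rewrite e.
- exists (dual_potential X zs z0 c); split.
    exact: (bidual_potentialE bX bY Xx1 zs0 zsY).
  exact: (dual_potentialE2 bX bY Xx1 zs0 zsY).
Qed.

End BrenierPotential.

(** * Upper and lower bounds for Wasserstein distances *)

Section WassersteinBounds.
Context {R : realType} {d : nat}.
Local Notation E := (borel_rV R d).
Local Notation V := 'rV[R]_d.
Local Open Scope ereal_scope.

Lemma poweR_le (x y : \bar R) (r : R) : (0 <= r)%R -> 0 <= x -> x <= y ->
  x `^ r <= y `^ r.
Proof.
move=> r0 x0 xy; apply: gt0_ler_poweR => //; rewrite in_itv/= leey andbT //.
exact: le_trans xy.
Qed.

Lemma enorm_ge0 (x : V) : (0 <= enorm x)%R.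
Proof. exact: sqrtr_ge0. Qed.

Lemma measurable_enorm : measurable_fun setT (fun x : E => enorm (x : V)).
Proof.
rewrite (_ : (fun _ => _) = (fun x : E => (dotv (x : V) (x : V)) `^ 2^-1)%R).
  apply: (measurableT_comp (measurable_powR _)).
  exact: (@measurable_dotv _ _ _ _ id id).
by apply/funext => x; rewrite powR12_sqrt ?dotv_ge0.
Qed.

Lemma integral_cst_indic {d0} {T : measurableType d0} (P : probability T R)
    (A : set T) (k : R) : measurable A -> (0 <= k)%R ->
  \int[P]_x (k * \1_A x)%:E = k%:E * P A.
Proof.
move=> mA k0; under eq_integral do rewrite EFinM.
rewrite ge0_integralZl ?lee_fin// ?integral_indic ?setIT//.
by apply/measurable_EFinP; exact: measurable_indic.
Qed.

(** The [L^r] norm of a displacement of length [tau] on a set of mass [e]. *)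
Definition wasserstein_rate (tau e : R) (r : \bar R) : R :=
  if r is s%:E then (tau * e `^ s^-1)%R else tau.

(** The law of [(S, T)] is a coupling that moves only the mass of [A], by at most
[tau]. *)
Lemma wasserstein_map_le {d0} {T0 : measurableType d0} (P : probability T0 R)
    (S T : T0 -> E)
    (mS : measurable_fun setT S) (mT : measurable_fun setT T)
    (mu0 mu1 : probability E R) (A : set T0) (tau e : R) (r : \bar R) :
  (forall B, measurable B -> mu0 B = P (S @^-1` B)) ->
  (forall B, measurable B -> mu1 B = P (T @^-1` B)) ->
  measurable A -> P A <= e%:E -> (0 <= tau)%R -> 1 <= r ->
  (forall x, A x -> enorm ((T x : V) - S x) <= tau)%R ->
  (forall x, ~ A x -> S x = T x) ->
  wasserstein r mu0 mu1 <= (wasserstein_rate tau e r)%:E.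
Proof.
move=> mu0E mu1E mA Ae tau0 r1 STA STnA.
have STn x : (enorm ((S x : V) - T x) <= tau * \1_A x)%R.
  rewrite indicE; have [Ax|nAx] := pselect (A x).
    rewrite mem_set// mulr1 -opprB /enorm dotvNl dotvC dotvNl opprK.
    exact: STA.
  by rewrite memNset// mulr0 STnA// subrr /enorm dotv0l sqrtr0.
pose g := law P (measurable_pair mS mT).
apply: (@le_trans _ _ (Lnorm g r (fun z => (enorm ((z.1 : V) - z.2))%:E))).
  apply: ereal_inf_lbound; exists g => //; split.
    by move=> B mB; rewrite mu0E.
  by move=> B mB; rewrite mu1E.
have mEn : measurable_fun setT (fun z : E * E => enorm ((z.1 : V) - z.2)).
  by apply: (measurableT_comp measurable_enorm); apply: measurable_vecB.
have e0 : (0 <= e)%R by rewrite -lee_fin (le_trans _ Ae).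
case: r r1 => [s||//] s1; rewrite unlock /wasserstein_rate.
  have s0 : (0 < s)%R by move: s1; rewrite lee_fin; exact: lt_le_trans ltr01.
  have h : \int[g]_z (enorm ((z.1 : V) - z.2))%:E `^ s <= (tau `^ s * e)%:E.
    rewrite ge0_integral_law; last 2 first.
    - under eq_fun do rewrite poweR_EFin.
      apply/measurable_EFinP.
      exact: (measurableT_comp (measurable_powR _) mEn).
    - by move=> z; exact: poweR_ge0.
    apply: (@le_trans _ _ (\int[P]_x (tau `^ s * \1_A x)%:E)).
      apply: le_integral_nonmeas => x /=; rewrite lee_fin.
      have := STn x; rewrite indicE; case: (x \in A) => /= h.
        rewrite mulr1 ge0_ler_powR ?nnegrE ?enorm_ge0 ?(ltW s0)//.
        by rewrite mulr1 in h.
      rewrite mulr0 in h *; have -> : enorm ((S x : V) - T x) = 0%R.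
        by apply/eqP; rewrite eq_le h enorm_ge0.
      by rewrite powR0// gt_eqF.
    by rewrite integral_cst_indic ?powR_ge0// EFinM lee_wpmul2l ?lee_fin ?powR_ge0.
  under eq_integral do rewrite gee0_abs ?lee_fin ?enorm_ge0//.
  apply: le_trans (poweR_le _ _ h) _.
  - by rewrite invr_ge0 ltW.
  - by apply: integral_ge0 => z _; exact: poweR_ge0.
  rewrite poweR_EFin powRM ?powR_ge0// -powRrM mulfV ?gt_eqF// powRr1//.
have gT : 0 < g setT by rewrite [X in _ < X](_ : _ = 1)//; exact: probability_setT.
rewrite gT; apply/ess_supP.
exists (~` [set z : E * E | (enorm ((z.1 : V) - z.2) <= tau)%R]).
have mN : measurable [set z : E * E | (enorm ((z.1 : V) - z.2) <= tau)%R].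
  rewrite -[X in measurable X]setTI.
  have -> : [set z : E * E | (enorm ((z.1 : V) - z.2) <= tau)%R] =
    (fun z : E * E => enorm ((z.1 : V) - z.2)) @^-1` `]-oo, tau].
    by apply/seteqP; split => z /=; rewrite in_itv.
  by apply: mEn => //; exact: measurable_itv.
split; first exact: measurableC.
  change (P ((fun x => (S x, T x)) @^-1` ~` [set z : E * E | (enorm ((z.1 : V) - z.2) <= tau)%R]) = 0).
  rewrite (_ : _ @^-1` _ = set0) ?measure0//.
  apply/seteqP; split => x //=; apply; apply: le_trans (STn x) _.
  by rewrite ler_piMr// indicE lern1 leq_b1.
by move=> z /= H H2; apply: H; rewrite lee_fin ger0_norm ?enorm_ge0.
Qed.

Lemma wasserstein_ge0 r (mu0 mu1 : probability E R) : 0 <= wasserstein r mu0 mu1.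
Proof. by apply: le_ereal_inf_tmp => _ [g _ <-]; exact: Lnorm_ge0. Qed.

Lemma wasserstein_self (mu : probability E R) : wasserstein 1 mu mu = 0.
Proof.
apply/eqP; rewrite eq_le wasserstein_ge0 andbT.
have := @wasserstein_map_le _ _ mu id id (@measurable_id _ E setT)
  (@measurable_id _ E setT) mu mu setT 0 1 1.
rewrite /wasserstein_rate mul0r; apply => //; first exact: probability_le1.
by move=> x _; rewrite subrr /enorm dotv0l sqrtr0.
Qed.

(** At least [m1 - m0] of the mass that the second plan gives to [S1] is coupled
with points outside [S0], and this part travels at least [delta] in one of the
two factors. *)
Lemma wasserstein_plan_ge (q delta m0 m1 : R)
    (g0 g1 : probability (E * E)%type R) (S0 S1 : set (E * E)) :
  (1 <= q)%R -> (0 <= delta)%R -> (m0 <= m1)%R ->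
  measurable S0 -> measurable S1 -> g0 S0 <= m0%:E -> m1%:E <= g1 S1 ->
  (forall z0 z1 : E * E, ~ S0 z0 -> S1 z1 ->
    (delta <= enorm ((z0.1 : V) - z1.1))%R \/
    (delta <= enorm ((z0.2 : V) - z1.2))%R) ->
  (delta * (m1 - m0) `^ q^-1)%:E <= wasserstein_plan q g0 g1.
Proof.
move=> q1 d0 m01 mS0 mS1 gS0 gS1 sep.
have q0 : (0 < q)%R by rewrite (lt_le_trans _ q1).
have -> : (delta * (m1 - m0) `^ q^-1)%:E = (delta `^ q * (m1 - m0))%:E `^ q^-1.
  by rewrite poweR_EFin powRM ?powR_ge0 ?subr_ge0// -powRrM mulfV ?gt_eqF// powRr1.
have dm0 : (0 <= delta `^ q * (m1 - m0))%R by rewrite mulr_ge0 ?powR_ge0 ?subr_ge0.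
apply: poweR_le; rewrite ?lee_fin ?invr_ge0 ?(ltW q0)//.
apply: le_ereal_inf_tmp => _ [p cp <-].
pose Z : set ((E * E) * (E * E)) := (snd @^-1` S1) `\` (fst @^-1` S0).
have m_fst : measurable (fst @^-1` S0 : set ((E * E) * (E * E))).
  by rewrite -[X in measurable X]setTI; exact: measurable_fst.
have m_snd : measurable (snd @^-1` S1 : set ((E * E) * (E * E))).
  by rewrite -[X in measurable X]setTI; exact: measurable_snd.
have mZ : measurable Z by exact: measurableD.
have pZ : (m1 - m0)%:E <= p Z.
  have h0 : p (fst @^-1` S0) = g0 S0 by exact: cp.1.
  have h1 : p (snd @^-1` S1) = g1 S1 by exact: cp.2.
  rewrite EFinB leeBlDr//; apply: le_trans gS1 _; rewrite -h1.
  rewrite (measureDI p m_snd m_fst); apply: leeD => //.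
  apply: le_trans gS0; rewrite -h0; apply: le_measure; rewrite ?inE//.
  exact: measurableI.
apply: (@le_trans _ _ (\int[p]_z (delta `^ q * \1_Z z)%:E)).
  rewrite integral_cst_indic ?powR_ge0// EFinM lee_wpmul2l// lee_fin powR_ge0 //.
apply: le_integral_nonmeas => -[z0 z1] /=; rewrite lee_fin indicE.
have [/set_mem [/= H1 H0]|_] := boolP ((z0, z1) \in Z); last first.
  by rewrite mulr0 addr_ge0 ?powR_ge0.
rewrite mulr1; have [h|h] := sep _ _ H0 H1.
  rewrite ler_wpDr ?powR_ge0// ge0_ler_powR ?nnegrE ?enorm_ge0 ?(ltW q0)//.
by rewrite ler_wpDl ?powR_ge0// ge0_ler_powR ?nnegrE ?enorm_ge0 ?(ltW q0).
Qed.

Lemma Lnorm_ge_on (P : probability E R) (f : E -> R) (q delta m : R) (S : set E) :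
  (1 <= q)%R -> (0 <= delta)%R -> (0 <= m)%R -> measurable S -> m%:E <= P S ->
  {ae P, forall x, S x -> delta <= f x}%R ->
  (delta * m `^ q^-1)%:E <= Lnorm P q%:E (fun x => (f x)%:E).
Proof.
move=> q1 d0 m0 mS PS fS.
have q0 : (0 < q)%R by rewrite (lt_le_trans _ q1).
have -> : (delta * m `^ q^-1)%:E = (delta `^ q * m)%:E `^ q^-1.
  by rewrite poweR_EFin powRM ?powR_ge0// -powRrM mulfV ?gt_eqF// powRr1.
rewrite unlock; apply: poweR_le; rewrite ?invr_ge0 ?(ltW q0)//.
  by rewrite lee_fin mulr_ge0 ?powR_ge0.
apply: (@le_trans _ _ (\int[P]_z (delta `^ q * \1_S z)%:E)).
  by rewrite integral_cst_indic ?powR_ge0// EFinM lee_wpmul2l// lee_fin powR_ge0.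
apply: le_integral_ae_lb.
  by apply: measurable_funM; [exact: measurable_cst|exact: measurable_indic].
apply: filterS fS => x; rewrite indicE; case: (boolP (x \in S)) => [/set_mem Sx|_ _].
  move=> /(_ Sx) h; rewrite mulr1 poweR_EFin lee_fin.
  rewrite ge0_ler_powR ?nnegrE ?(ltW q0)//.
  by rewrite (le_trans h)// ler_norm.
by rewrite mulr0 poweR_ge0.
Qed.

End WassersteinBounds.

(** * The scales of the construction *)

Section Scales.
Context {R : realType}.
Variable theta : R.
Hypotheses (th0 : 0 < theta) (th1 : theta <= 1).

Definition gap k : R := 2 `^ (- k%:R).
Definition width k : R := 2 `^ (- (k%:R ^+ 2) / theta).
(** The mass of the slabs of index at least [k]. It equals [width k `^ theta] up to
the factor [gap k ^+ 2], and the powers of [gap k] are negligible against those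
of [width k]. *)
Definition tail k : R := 2 `^ (- (k%:R ^+ 2 + 2 * k%:R)).

Let two0 : 0 < 2 :> R. Proof. by []. Qed.
Let p2D (x y : R) : 2 `^ (x + y) = 2 `^ x * 2 `^ y.
Proof. by rewrite powRD// (gt_eqF two0) implybT. Qed.
Let p2le (x y : R) : x <= y -> 2 `^ x <= 2 `^ y.
Proof. by apply: ler_powR; rewrite ler1n. Qed.

Lemma gap_gt0 k : 0 < gap k. Proof. exact: powR_gt0. Qed.
Lemma width_gt0 k : 0 < width k. Proof. exact: powR_gt0. Qed.
Lemma tail_gt0 k : 0 < tail k. Proof. exact: powR_gt0. Qed.

Lemma gapS k : gap k.+1 = gap k / 2.
Proof.
rewrite /gap -[k.+1%:R]natr1 opprD p2D; congr (_ * _).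
by rewrite powR_inv1.
Qed.

Lemma gap_le k n : (k <= n)%N -> gap n <= gap k.
Proof. by move=> kn; apply: p2le; rewrite lerN2 ler_nat. Qed.

Lemma gap_lt k n : (k < n)%N -> gap n <= gap k / 2.
Proof. by move=> kn; rewrite -gapS; exact: gap_le. Qed.

Lemma gap_le1 k : gap k <= 1.
Proof. by rewrite -[leRHS](powRr0 2) p2le// oppr_le0. Qed.

Lemma gap_expr k : gap k = (2^-1) ^+ k.
Proof. by rewrite /gap powRN powR_mulrn// exprVn. Qed.

Lemma width_le k n : (k <= n)%N -> width n <= width k.
Proof.
move=> kn; apply: p2le; rewrite ler_pM2r ?invr_gt0// lerN2.
by rewrite lerXn2r ?nnegrE// ler_nat.
Qed.

Lemma width_le_gap k : width k <= gap k.
Proof.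
apply: p2le; rewrite mulNr lerN2 ler_pdivlMr//.
apply: (@le_trans _ _ k%:R); first by rewrite ler_piMr.
by rewrite -natrX ler_nat; case: k => // k; rewrite leq_pmull.
Qed.

Lemma tail0 : tail 0 = 1.
Proof. by rewrite /tail expr0n/= mulr0 addr0 oppr0 powRr0. Qed.

Lemma tail_le k n : (k <= n)%N -> tail n <= tail k.
Proof.
move=> kn; apply: p2le; rewrite lerN2; apply: lerD.
  by rewrite lerXn2r ?nnegrE// ler_nat.
by rewrite ler_pM2l// ler_nat.
Qed.

Lemma tail_width k : tail k = width k `^ theta * gap k ^+ 2.
Proof.
rewrite /tail /width /gap -powRrM divfK ?gt_eqF// -powR_mulrn ?powR_ge0//.
by rewrite -powRrM -p2D; congr (_ `^ _); ring.
Qed.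

Lemma cvg_gap0 : gap k @[k --> \oo] --> 0.
Proof.
under eq_fun do rewrite gap_expr.
by apply: cvg_expr; rewrite ger0_norm; lra.
Qed.

Lemma tail_le_gap k : tail k <= gap k.
Proof.
apply: p2le; rewrite lerN2.
have : 0 <= k%:R :> R by [].
by have := sqr_ge0 (k%:R : R); lra.
Qed.

Lemma cvg_tail0 : tail k @[k --> \oo] --> 0.
Proof.
apply: (@squeeze_cvgr _ _ _ _ (fun=> 0) gap); last 2 first.
- exact: cvg_cst.
- exact: cvg_gap0.
by apply: nearW => k; rewrite ltW ?tail_gt0//= tail_le_gap.
Qed.

(** Steep enough for the tilted pieces to win on all slabs of index at least [n]:
over the radius of the box they gain [slope Delta n * (gap n / 4)] there,
whereas the two untilted pieces differ by at most [2 * Delta * width n]. *)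
Definition slope (Delta : R) n : R := 16 * Delta * (width n / gap n).

Lemma slope_ge0 Delta n : 0 <= Delta -> 0 <= slope Delta n.
Proof.
move=> D0; apply: mulr_ge0; first exact: mulr_ge0.
by apply: divr_ge0; exact: powR_ge0.
Qed.

Lemma slope_le Delta n : 0 <= Delta -> slope Delta n <= 16 * Delta.
Proof.
move=> D0; rewrite ler_piMr ?mulr_ge0// ler_pdivrMr ?gap_gt0// mul1r.
exact: width_le_gap.
Qed.

Definition inv_exponent (r : \bar R) : R := if r is s%:E then s^-1 else 0.

Lemma wasserstein_rateE tau e r :
  wasserstein_rate tau e r = tau * e `^ inv_exponent r :> R.
Proof. by case: r => [s||] //=; rewrite powRr0 mulr1. Qed.

(** In terms of [w = width n] the plans are [w `^ (theta / q)] apart and the targets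
[w `^ (1 + theta / r)]; the exponent is critical when the power [alpha] of the
second equals the first. The last claim is this comparison divided by
[theta]. *)
Lemma critical_exponent_gain q (r : \bar R) alpha :
  1 <= q -> (1 <= r)%E -> critical_exponent theta q r < alpha ->
  [/\ 0 < alpha, 0 <= inv_exponent r &
      0 < alpha * (theta^-1 + inv_exponent r) - q^-1].
Proof.
move=> q1 r1; have q0 : 0 < q by rewrite (lt_le_trans _ q1).
case: r r1 => [s||//] /=; last first.
  move=> _ h; split => //; first by rewrite (lt_trans _ h)// divr_gt0.
  rewrite addr0 subr_gt0 -(ltr_pM2r th0) mulfVK ?gt_eqF//.
  by rewrite mulrC.
rewrite lee_fin => s1; have s0 : 0 < s by rewrite (lt_le_trans _ s1).
have st0 : 0 < s + theta by rewrite addr_gt0.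
move=> h; split; first by rewrite (lt_trans _ h)// divr_gt0// mulr_gt0.
  by rewrite invr_ge0 ltW.
rewrite subr_gt0.
have -> : q^-1 = s * theta / (q * (s + theta)) * (theta^-1 + s^-1).
  field; apply/and4P; split; by rewrite gt_eqF.
by rewrite ltr_pM2r// addr_gt0// invr_gt0.
Qed.

(** The base 2 logarithm of the ratio of the two sides is [ka * n ^ 2] up to terms
linear in [n], and [ka] is positive above the critical exponent. *)
Lemma plan_gap_dominates (rr Delta q alpha C : R) (r : \bar R) :
  0 < rr -> 0 < Delta -> 1 <= q -> (1 <= r)%E ->
  critical_exponent theta q r < alpha ->
  exists N : nat, forall n, (N <= n)%N ->
    C * wasserstein_rate (slope Delta n) (tail n) r `^ alpha <=
    Num.min (rr * gap n / 4) Delta * (tail n / 4) `^ q^-1.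
Proof.
move=> rr0 D0 q1 r1 crit; have q0 : 0 < q by rewrite (lt_le_trans _ q1).
have [al0 io0 ka0] := critical_exponent_gain q1 r1 crit.
set io := inv_exponent r in io0 ka0; set ka := _ - q^-1 in ka0.
pose B := 1 + 2 / q + alpha.
pose c0 := Num.min (rr / 4) Delta * (4^-1) `^ q^-1.
have m0 : 0 < Num.min (rr / 4) Delta by rewrite lt_min D0 divr_gt0.
have c00 : 0 < c0 by rewrite mulr_gt0// powR_gt0// invr_gt0.
pose C1 := (16 * Delta) `^ alpha.
have C10 : 0 <= C1 by exact: powR_ge0.
pose N1 := Num.truncn ((B + 1) / ka).
pose N2 := Num.truncn (`|C| * C1 / c0).
exists (maxn N1 N2).+1 => n nN.
have n1 : (B + 1) / ka <= n%:R.
  have h1 : 0 <= (B + 1) / ka.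
    by rewrite divr_ge0 ?(ltW ka0)// !addr_ge0// ?divr_ge0 ?ltW.
  have /andP[_ /ltW h2] := truncn_itv h1.
  by apply: le_trans h2 _; rewrite ler_nat (leq_trans _ nN)// ltnS leq_maxl.
have n2 : `|C| * C1 / c0 <= n%:R.
  have h1 : 0 <= `|C| * C1 / c0 by rewrite divr_ge0 ?(ltW c00)// mulr_ge0.
  have /andP[_ /ltW h2] := truncn_itv h1.
  by apply: le_trans h2 _; rewrite ler_nat (leq_trans _ nN)// ltnS leq_maxr.
have n0 : 0 <= n%:R :> R by [].
have rate : wasserstein_rate (slope Delta n) (tail n) r `^ alpha =
    C1 * 2 `^ (alpha * (- (n%:R ^+ 2) / theta + n%:R
                        - (n%:R ^+ 2 + 2 * n%:R) * io)).
  rewrite wasserstein_rateE /slope -/io /C1.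
  have -> : width n / gap n = 2 `^ (- (n%:R ^+ 2) / theta + n%:R).
    by rewrite p2D /gap powRN invrK.
  rewrite -mulrA powRM ?mulr_ge0 ?powR_ge0 ?(ltW D0)//; congr (_ * _).
  rewrite /tail -powRrM -p2D -powRrM; congr (_ `^ _); ring.
have low : c0 * 2 `^ (- n%:R - (n%:R ^+ 2 + 2 * n%:R) / q) <=
    Num.min (rr * gap n / 4) Delta * (tail n / 4) `^ q^-1.
  rewrite powRM ?(ltW (tail_gt0 _)) ?invr_ge0// /c0.
  have -> : tail n `^ q^-1 = 2 `^ (- (n%:R ^+ 2 + 2 * n%:R) / q).
    by rewrite /tail -powRrM.
  rewrite p2D mulNr -/(gap n).
  set m := Num.min (rr / 4) Delta in m0 *.
  set f := 4^-1 `^ q^-1; set t := 2 `^ _.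
  rewrite [leLHS](_ : _ = m * gap n * (t * f)); last by ring.
  rewrite ler_wpM2r ?mulr_ge0 ?powR_ge0//.
  rewrite le_min; apply/andP; split.
    rewrite mulrAC ler_wpM2r ?(ltW (gap_gt0 _))//.
    by rewrite /m ge_min lexx.
  apply: (@le_trans _ _ (Delta * 1)); last by rewrite mulr1.
  by apply: ler_pM; rewrite ?(ltW m0) ?(ltW (gap_gt0 _)) ?gap_le1// /m ge_min lexx orbT.
apply: le_trans low; rewrite rate.
set x := alpha * _; set y := - n%:R - _.
have xy : x + n%:R <= y.
  have kn : B + 1 <= ka * n%:R by rewrite mulrC -ler_pdivrMr.
  have kn2 := ler_wpM2r n0 kn.
  have ai : 0 <= alpha * n%:R * io by rewrite !mulr_ge0// ltW.
  rewrite -subr_ge0.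
  have -> : y - (x + n%:R) =
     (ka * n%:R * n%:R - (B + 1) * n%:R) + 2 * (alpha * n%:R * io).
    by rewrite /x /y /ka /B; ring.
  by rewrite addr_ge0 ?subr_ge0// mulr_ge0.
apply: (@le_trans _ _ (`|C| * C1 * 2 `^ x)).
  by rewrite mulrA ler_wpM2r ?powR_ge0// ler_wpM2r// ler_norm.
apply: (@le_trans _ _ (c0 * 2 `^ (x + n%:R))); last first.
  by rewrite ler_pM2l// p2le.
rewrite p2D [2 `^ x * _]mulrC mulrA ler_wpM2r ?powR_ge0//.
rewrite -ler_pdivrMl// mulrC; apply: le_trans n2 _.
rewrite powR_mulrn// -natrX ler_nat.
exact/ltnW/ltn_expl.
Qed.

End Scales.

(** * The uniform measure on a cube *)

Section UniformCube.
Context {R : realType} {d : nat}.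
Local Notation E := (borel_rV R d).
Local Notation V := 'rV[R]_d.
Local Notation RR := (measurableTypeR R).

Definition cube : probability E R := iid unif d.
Definition in_cube (u : V) := forall i, `|u ord0 i| <= 1.

Lemma measurable_in_cube : measurable (in_cube : set E).
Proof.
apply: (@measurable_box _ _ (fun=> [set x : RR | `|x| <= 1])) => _.
rewrite (_ : [set x | _] = `[-1, 1]%classic); first exact: measurable_itv.
by apply/seteqP; split => u /=; rewrite in_itv/= ler_norml.
Qed.

Lemma cube_in_cube : cube in_cube = 1%E.
Proof.
have mA (i : 'I_d) : measurable [set x : RR | `|x| <= 1].
  rewrite (_ : [set x | _] = `[-1, 1]%classic); first exact: measurable_itv.
  by apply/seteqP; split => u /=; rewrite in_itv/= ler_norml.
rewrite [LHS](iid_box unif mA) big1// => i _.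
by rewrite [X in fine X]unif_support.
Qed.

Lemma cube_outside (A : set E) : measurable A ->
  (forall u, in_cube u -> ~ A u) -> cube A = 0%E.
Proof.
move=> mA AC; apply/eqP; rewrite eq_le measure_ge0 andbT.
have mC := measurable_in_cube.
have e : cube (~` in_cube) = 0%E.
  by rewrite probability_setC// cube_in_cube subee.
rewrite -e; apply: le_measure; rewrite ?inE//; first exact: measurableC.
by move=> u Au Cu; exact: AC Cu Au.
Qed.

Lemma cube_congr (A B : set E) : measurable A -> measurable B ->
  (forall u, in_cube u -> A u <-> B u) -> cube A = cube B.
Proof.
move=> mA mB AB.
have le (S S' : set E) : measurable S -> measurable S' ->
    (forall u, in_cube u -> S u -> S' u) -> (cube S <= cube S')%E.
  move=> mS mS' SS';
  have SS0 : cube (S `\` S') = 0%E.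
    by apply: cube_outside; [exact: measurableD|move=> u Cu [Su]; apply; exact: SS'].
  rewrite (measureDI _ mS mS') [X in (X + _)%E]SS0.
  rewrite add0e; apply: le_measure; rewrite ?inE//; first exact: measurableI.
apply/eqP; rewrite eq_le !le// => u Cu; [move/AB|move/AB]; exact.
Qed.

Lemma cube_two_coords (i0 i1 : 'I_d) (A B : set RR) : i0 != i1 ->
  measurable A -> measurable B ->
  cube [set u | A ((u : V) ord0 i0) /\ B ((u : V) ord0 i1)] =
  (fine (unif A) * fine (unif B))%:E.
Proof.
move=> i01 mA mB.
pose F i : set RR := if i == i0 then A else if i == i1 then B else setT.
have mF i : measurable (F i) by rewrite /F; case: ifP => // _; case: ifP.
have i10 : (i1 == i0) = false by rewrite eq_sym; exact/negbTE.
rewrite (_ : [set u | _] = [set u | forall i, F i ((u : V) ord0 i)]); last first.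
  apply/seteqP; split => u /=.
    by move=> [Au Bu] i; rewrite /F; case: eqP => [->//|_]; case: eqP => [->|].
  move=> Fu; split; first by have := Fu i0; rewrite /F eqxx.
  by have := Fu i1; rewrite /F i10 eqxx.
rewrite [LHS](iid_box unif mF) (bigD1 i0)//= (bigD1 i1)/=; last by rewrite eq_sym.
rewrite big1 ?mulr1; first by rewrite /F eqxx i10 eqxx.
move=> i /andP[n0 n1]; rewrite /F (negbTE n0) (negbTE n1).
by rewrite [X in fine X](@probability_setT _ _ _ unif).
Qed.

Lemma measurable_npos : measurable [set u : RR | ~ (0 < u)%R].
Proof. by apply: measurableC; exact: measurable_pos. Qed.

Lemma unif_npos : unif [set u : R | ~ 0 < u] = (2^-1)%:E.
Proof.
rewrite (_ : [set u | _] = ~` [set u : R | 0 < u])//.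
rewrite [LHS](probability_setC unif measurable_pos) unif_pos -EFinB.
by congr (_%:E); lra.
Qed.

Definition sign_set (b : bool) : set RR :=
  if b then [set u | 0 < u] else [set u | ~ 0 < u].

Lemma measurable_sign_set b : measurable (sign_set b).
Proof. by case: b; [exact: measurable_pos|exact: measurable_npos]. Qed.

Lemma sign_setP b x : sign_set b x <-> (0 < x) = b.
Proof. by case: b => //=; split => [/negP/negbTE//|->]. Qed.

Lemma unif_sign_set b : fine (unif (sign_set b)) = 2^-1.
Proof.
by case: b; rewrite /sign_set ?[X in fine X]unif_pos// [X in fine X]unif_npos.
Qed.

Lemma measurable_sign_coord (i : 'I_d) b :
  measurable [set u : E | (0 < (u : V) ord0 i) = b].
Proof.
rewrite -[X in measurable X]setTI.
have := measurable_fun_ltr (@measurable_cst _ _ E R setT 0) (@measurable_coord R d i).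
by move=> /(_ measurableT [set b] I); rewrite setTI.
Qed.

Lemma cube_half (i0 i1 : 'I_d) (b : bool) : i0 != i1 ->
  cube [set u | (0 < (u : V) ord0 i0) = b] = (2^-1)%:E.
Proof.
move=> i01.
rewrite (_ : [set u | _] =
    [set u | sign_set b ((u : V) ord0 i0) /\ setT ((u : V) ord0 i1)]).
  rewrite (cube_two_coords i01 (measurable_sign_set b) measurableT) unif_sign_set.
  by rewrite [X in _ * fine X](@probability_setT _ _ _ unif) mulr1.
apply/seteqP; split => u /=; first by move=> /sign_setP.
by move=> [/sign_setP].
Qed.

Lemma cube_quarter (i0 i1 : 'I_d) (b0 b1 : bool) : i0 != i1 ->
  cube [set u | (0 < (u : V) ord0 i0) = b0 /\ (0 < (u : V) ord0 i1) = b1]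
  = (4^-1)%:E.
Proof.
move=> i01.
rewrite (_ : [set u | _] =
    [set u | sign_set b0 ((u : V) ord0 i0) /\ sign_set b1 ((u : V) ord0 i1)]).
  rewrite (cube_two_coords i01 (measurable_sign_set b0) (measurable_sign_set b1)).
  by rewrite !unif_sign_set; congr (_%:E); lra.
by apply/seteqP; split => u /=; rewrite !sign_setP.
Qed.

Lemma unif0 : unif [set 0 : R] = 0%E.
Proof.
apply/eqP; rewrite eq_le measure_ge0 andbT; apply/lee_addgt0Pr => e e0.
rewrite add0e; apply: le_trans (unif_itv_le 0 (ltW e0)).
apply: le_measure; rewrite ?inE.
- by rewrite -[[set 0]]set_itv1; exact: measurable_itv.
- rewrite (_ : [set u : R | _] = `]0 - e, 0 + e[%classic); first exact: measurable_itv.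
  by apply/seteqP; split => u /=; rewrite in_itv.
- by move=> u ->/=; rewrite sub0r add0r oppr_lt0 e0.
Qed.

Lemma cube_coord0 (i0 i1 : 'I_d) : i0 != i1 ->
  cube [set u | (u : V) ord0 i0 = 0] = 0%E.
Proof.
move=> i01.
have m0 : measurable ([set 0] : set RR) by rewrite -[[set 0]]set_itv1; exact: measurable_itv.
rewrite (_ : [set u | _] =
    [set u | [set (0:R)] ((u : V) ord0 i0) /\ setT ((u : V) ord0 i1)]); last first.
  by apply/seteqP; split => u //= [].
by rewrite (cube_two_coords i01 m0 measurableT) [X in fine X * _]unif0 mul0r.
Qed.

(** The signs of two coordinates have the same law. This symmetry hides from the
targets the exchange of mass that the plans see. *)
Lemma cube_sign_law (i0 i1 : 'I_d) (B : bool -> Prop) : i0 != i1 ->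
  cube [set u | B (0 < (u : V) ord0 i0)] = cube [set u | B (0 < (u : V) ord0 i1)].
Proof.
move=> i01; have i10 : i1 != i0 by rewrite eq_sym.
have [Bt|nBt] := pselect (B true); have [Bf|nBf] := pselect (B false).
- congr (cube _); apply/seteqP; split => u /= _; by case: (0 < _).
- transitivity (2^-1 : R)%:E; [rewrite -(cube_half true i01)|rewrite -(cube_half true i10)];
    congr (cube _); apply/seteqP; split => u /=; case: (0 < _) => //.
- transitivity (2^-1 : R)%:E; [rewrite -(cube_half false i01)|rewrite -(cube_half false i10)];
    congr (cube _); apply/seteqP; split => u /=; case: (0 < _) => //.
- congr (cube _); apply/seteqP; split => u /=; by case: (0 < _).
Qed.

End UniformCube.

(** * The cusp measure *)

Section CuspMeasure.
Context {R : realType} {d : nat}.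
Local Notation E := (borel_rV R d).
Local Notation V := 'rV[R]_d.
Local Notation RR := (measurableTypeR R).
Variable theta : R.
Hypotheses (th0 : 0 < theta) (th1 : theta <= 1).
Variables (i0 i1 : 'I_d) (i01 : i0 != i1).
Variables (x0 : V) (rr : R) (rr0 : 0 < rr).

Local Notation width := (@width R theta).
Local Notation gap := (@gap R).
Local Notation tail := (@tail R).

Definition sgp (v : R) : R := if 0 < v then 1 else -1.

(** In the direction [i1] the sign of [u] selects one of two opposite slabs. *)
Definition slab_coord k (i : 'I_d) (u : R) : R :=
  if i == i0 then width k * u
  else if i == i1 then sgp u * (1 - gap k) + gap k * u / 4 else u.

Definition slab_map k (u : E) : E :=
  \row_i (x0 ord0 i + rr * slab_coord k i ((u : V) ord0 i)).

Lemma measurable_sgp : measurable_fun setT (sgp : RR -> RR).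
Proof.
apply: measurable_fun_ifT; [|exact: measurable_cst|exact: measurable_cst].
by apply: measurable_fun_ltr.
Qed.

Lemma measurable_slab_coord k i : measurable_fun setT (slab_coord k i : RR -> RR).
Proof.
rewrite /slab_coord; case: (i == i0); first exact: measurable_funM.
case: (i == i1); last exact: measurable_id.
apply: measurable_funD.
  by apply: measurable_funM; [exact: measurable_sgp|exact: measurable_cst].
by apply: measurable_funM; [exact: measurable_funM|exact: measurable_cst].
Qed.

Lemma measurable_slab_map k : measurable_fun setT (slab_map k).
Proof.
apply: measurable_fun_row => i; under eq_fun do rewrite mxE.
apply: measurable_funD; first exact: measurable_cst.
apply: measurable_funM; first exact: measurable_cst.
exact: measurableT_comp (measurable_slab_coord k i) (measurable_coord i).
Qed.

Definition weight k : R := tail k - tail k.+1.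

Lemma weight_ge0 k : 0 <= weight k.
Proof. by rewrite subr_ge0 tail_le. Qed.

Definition cusp_series : {measure set E -> \bar R} :=
  mseries (fun k => mscale (NngNum (weight_ge0 k)) (law cube (measurable_slab_map k))) 0.

Lemma weight_tail_sum n (v : R) (m : nat) :
  \sum_(0 <= k < m) (weight k * (if (n <= k)%N then v else 0)) =
  v * (tail (minn n m) - tail m).
Proof.
elim: m => [|m ih]; first by rewrite big_geq// minn0 subrr mulr0.
rewrite big_nat_recr//= ih; have [nm|mn] := leqP n m.
  rewrite (minn_idPl (leqW nm)) /weight; ring.
rewrite (minn_idPr mn) !subrr; ring.
Qed.

Lemma weight_tail_series n (v : R) : 0 <= v ->
  (\sum_(0 <= k <oo) (weight k * (if (n <= k)%N then v else 0))%:E =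
   (v * tail n)%:E)%E.
Proof.
move=> v0; apply: cvg_lim => //.
under eq_fun do rewrite sumEFin weight_tail_sum.
apply: cvg_EFin; first exact: nearW.
rewrite -[v * tail n]subr0 -[X in _ - X](mulr0 v).
apply: (@cvg_trans _ (v * tail n - v * tail m @[m --> \oo])).
  apply: near_eq_cvg; near=> m.
  have nm : (n <= m)%N by near: m; exact: nbhs_infty_ge.
  by rewrite /= (minn_idPl nm) mulrBr.
apply: cvgB; first exact: cvg_cst.
by apply: cvgM; [exact: cvg_cst|exact: cvg_tail0].
Unshelve. all: by end_near. Qed.

Lemma cusp_seriesE A : cusp_series A =
  (\sum_(0 <= k <oo) (weight k)%:E * cube (slab_map k @^-1` A))%E.
Proof. by []. Qed.

Lemma cusp_series_setT : cusp_series setT = 1%E.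
Proof.
have := @weight_tail_series 0 1 ler01; rewrite mul1r tail0 => <-.
rewrite cusp_seriesE.
congr (limn _); apply/funext => m; apply: eq_bigr => k _.
rewrite leq0n mulr1 preimage_setT.
by rewrite [X in (_ * X)%E](@probability_setT _ _ _ cube) mule1.
Qed.

Definition cusp : probability E R := prob_of_measure cusp_series_setT.

Lemma cuspE A : cusp A =
  (\sum_(0 <= k <oo) (weight k)%:E * cube (slab_map k @^-1` A))%E.
Proof. by []. Qed.

Lemma cusp_tail n (v : R) (A : set E) : 0 <= v ->
  (forall k, (n <= k)%N -> cube (slab_map k @^-1` A) = v%:E) ->
  (forall k, (k < n)%N -> cube (slab_map k @^-1` A) = 0%E) ->
  cusp A = (v * tail n)%:E.
Proof.
move=> v0 Av A0; rewrite cuspE -weight_tail_series//.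
congr (limn _); apply/funext => m; apply: eq_bigr => k _.
by rewrite EFinM; case: leqP => [/Av ->//|/A0 ->]; rewrite !mule0.
Qed.

Lemma eq_cusp (A B : set E) :
  (forall k, cube (slab_map k @^-1` A) = cube (slab_map k @^-1` B)) ->
  cusp A = cusp B.
Proof.
move=> AB; rewrite !cuspE; congr (limn _); apply/funext => m.
by apply: eq_bigr => k _; rewrite AB.
Qed.

Lemma measurable_slab_preim k (A : set E) : measurable A ->
  measurable (slab_map k @^-1` A).
Proof.
by move=> mA; rewrite -[X in measurable X]setTI; exact: measurable_slab_map.
Qed.

(** The points of a slab on its median hyperplane, where the untilted kink sits,
have mass zero, so a property may be checked off them. *)
Lemma cusp_ae (A : set E) : measurable A ->
  (forall k u, in_cube (u : V) -> (u : V) ord0 i0 != 0 -> A (slab_map k u)) ->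
  cusp (~` A) = 0%E.
Proof.
move=> mA Ak.
have m0 : measurable [set u : E | (u : V) ord0 i0 = 0].
  rewrite (_ : [set u : E | _] = (fun u : E => (u : V) ord0 i0) @^-1` [set 0])//.
  rewrite -[X in measurable X]setTI; apply: measurable_coord => //.
have slab0 k : cube (slab_map k @^-1` (~` A)) = 0%E.
  have mB : measurable (slab_map k @^-1` (~` A)).
    by apply: measurable_slab_preim; exact: measurableC.
  have D0 : cube ((slab_map k @^-1` ~` A) `\` [set u : E | (u : V) ord0 i0 = 0]) = 0%E.
    apply: cube_outside; first exact: measurableD.
    by move=> u Cu [/= nA /eqP u0]; apply: nA; exact: Ak.
  apply/eqP; rewrite eq_le measure_ge0 andbT.
  rewrite (measureDI cube mB m0) [X in (X + _)%E]D0 add0e.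
  rewrite -[leRHS](cube_coord0 i01).
  by apply: le_measure; rewrite ?inE//; exact: measurableI.
by rewrite (@cusp_tail 0 0) ?mul0r// => k _; exact: slab0.
Qed.

Section SlabPoints.
Variables (k : nat) (u : V).
Let p := (slab_map k u : V) - x0.

Lemma slab_p0 : p ord0 i0 = rr * (width k * u ord0 i0).
Proof. by rewrite /p !mxE /slab_coord eqxx addrC addKr. Qed.

Lemma slab_p1 : p ord0 i1 =
  rr * (sgp (u ord0 i1) * (1 - gap k) + gap k * u ord0 i1 / 4).
Proof.
by rewrite /p !mxE /slab_coord eq_sym (negbTE i01) eqxx addrC addKr.
Qed.

Lemma slab_p0_sign : (0 < p ord0 i0) = (0 < u ord0 i0).
Proof. by rewrite slab_p0 pmulr_rgt0// pmulr_rgt0// width_gt0. Qed.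

Lemma slab_p1_sign : (0 < p ord0 i1) = (0 < u ord0 i1).
Proof.
rewrite slab_p1 pmulr_rgt0// /sgp; have g1 := @gap_le1 R k; have g0 := @gap_gt0 R k.
case: ifPn => [u0|]; first by apply/idP; have := mulr_gt0 g0 u0; lra.
rewrite -leNgt => u0; apply/negbTE; rewrite -leNgt.
have := mulr_ge0_le0 (ltW g0) u0. lra.
Qed.

Lemma slab_p1_norm : `|p ord0 i1| =
  rr * ((1 - gap k) + gap k * `|u ord0 i1| / 4).
Proof.
have g1 := @gap_le1 R k; have g0 := @gap_gt0 R k.
rewrite slab_p1 normrM (gtr0_norm rr0); congr (_ * _); rewrite /sgp.
case: ifPn => [u0|].
  rewrite (gtr0_norm u0) ger0_norm; first by ring.
  by have := mulr_gt0 g0 u0; lra.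
rewrite -leNgt => u0; rewrite (ler0_norm u0) ler0_norm; first by ring.
by have := mulr_ge0_le0 (ltW g0) u0; lra.
Qed.

Hypothesis Cu : in_cube u.

Lemma slab_box i : `|p ord0 i| <= rr.
Proof.
have g1 := @gap_le1 R k; have g0 := @gap_gt0 R k.
have w0 := @width_gt0 R theta k.
have w1 : width k <= 1 by rewrite (le_trans (width_le_gap th0 th1 k)).
have [->|n0] := eqVneq i i0.
  rewrite slab_p0 normrM (gtr0_norm rr0) ler_piMr ?(ltW rr0)// normrM (gtr0_norm w0).
  by rewrite mulr_ile1// ?(ltW w0).
have [->|n1] := eqVneq i i1.
  rewrite slab_p1_norm ler_piMr ?(ltW rr0)//.
  by have := ler_wpM2l (ltW g0) (Cu i1); lra.
rewrite /p !mxE /slab_coord (negbTE n0) (negbTE n1) addrC addKr.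
by rewrite normrM (gtr0_norm rr0) ler_piMr ?(ltW rr0).
Qed.

(** A level in the free interval between the slabs of index less than [n], which
end at [rr * (1 - 3 / 2 * gap n)] at most, and those of index at least [n],
which start at [rr * (1 - gap n)] at least. *)
Definition threshold n : R := rr * (1 - 5 / 4 * gap n).

Lemma slab_before n : (k < n)%N -> `|p ord0 i1| < threshold n.
Proof.
move=> kn; rewrite slab_p1_norm /threshold ltr_pM2l//.
have := @gap_lt R _ _ kn; have g0 := @gap_gt0 R k; have := ler_wpM2l (ltW g0) (Cu i1).
by lra.
Qed.

Lemma slab_after n : (n <= k)%N -> rr * (1 - gap n) <= `|p ord0 i1|.
Proof.
move=> nk; rewrite slab_p1_norm ler_pM2l//.
have := @gap_le R _ _ nk; have g0 := @gap_gt0 R k.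
by have := mulr_ge0 (ltW g0) (normr_ge0 (u ord0 i1)); lra.
Qed.

Lemma slab_narrow n : (n <= k)%N -> `|p ord0 i0| <= rr * width n.
Proof.
move=> nk; rewrite slab_p0 normrM (gtr0_norm rr0) ler_pM2l// normrM.
rewrite (gtr0_norm (width_gt0 _ _)); apply: le_trans (width_le th0 nk).
by rewrite ler_piMr ?(ltW (width_gt0 _ _)).
Qed.

End SlabPoints.

Lemma unif_affine_le (a b eta : R) : 0 < a -> 0 < eta ->
  (unif [set u : R | (`|a * u + b| < eta)%R] <= (eta / a)%:E)%E.
Proof.
move=> a0 eta0.
have -> : [set u : R | `|a * u + b| < eta] =
    [set u : R | - b / a - eta / a < u < - b / a + eta / a].
  apply/seteqP; split => u /=; rewrite ltr_norml;
    rewrite -mulrBl -mulrDl ltr_pdivrMr// ltr_pdivlMr// => /andP[h1 h2];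
    apply/andP; split; lra.
by apply: unif_itv_le; rewrite divr_ge0 ?ltW.
Qed.

Lemma measurable_abs_lt (f : RR -> RR) (eta : R) : measurable_fun setT f ->
  measurable ([set u | `|f u| < eta] : set RR).
Proof.
move=> mf.
rewrite (_ : [set u | _] = (fun u => `|f u|) @^-1` `]-oo, eta[).
  rewrite -[X in measurable X]setTI.
  have mg : measurable_fun setT (fun u : RR => `|f u| : RR).
    by apply: measurableT_comp.
  by apply: mg => //; exact: measurable_itv.
by apply/seteqP; split => u /=; rewrite in_itv.
Qed.

Lemma measurable_affine (a b : R) :
  measurable_fun setT (fun u : RR => a * u + b : RR).
Proof.
by apply: measurable_funD; [exact: measurable_funM|exact: measurable_cst].
Qed.

Definition slab_hit k (z : V) (eta : R) i : set RR :=
  [set u | `|x0 ord0 i + rr * slab_coord k i u - z ord0 i| < eta].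

Lemma measurable_slab_hit k z eta i : measurable (slab_hit k z eta i).
Proof.
apply: measurable_abs_lt.
apply: measurable_funB; last exact: measurable_cst.
apply: measurable_funD; first exact: measurable_cst.
by apply: measurable_funM; [exact: measurable_cst|exact: measurable_slab_coord].
Qed.

(** Across the slab the proportion of mass is at most [v = eta / (rr * width k)] and
at most [1], hence at most [v `^ theta]. In the direction [i1] there are two opposite slabs. *)
Definition hit_bound k (eta : R) i : R :=
  if i == i0 then (eta / (rr * width k)) `^ theta
  else if i == i1 then 8 * (eta / rr) / gap k else eta / rr.

Lemma slab_hit_le k z eta i : 0 < eta ->
  fine (unif (slab_hit k z eta i)) <= hit_bound k eta i.
Proof.
move=> eta0.
have mH := measurable_slab_hit k z eta i.
have fH : unif (slab_hit k z eta i) \is a fin_num by exact: fin_num_measure.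
rewrite -lee_fin fineK// /hit_bound.
have g0 := @gap_gt0 R k; have w0 := @width_gt0 R theta k.
have [e0|n0] := eqVneq i i0.
  set v := eta / _.
  have v0 : 0 < v by rewrite divr_gt0 ?mulr_gt0.
  have [v1|v1] := lerP 1 v.
    apply: le_trans (probability_le1 unif mH) _.
    have := @ge0_ler_powR R theta (ltW th0) 1 v.
    by rewrite powR1 lee_fin => -> //; rewrite nnegrE ltW.
  apply: (@le_trans _ _ v%:E).
    rewrite (_ : slab_hit k z eta i =
      [set u | `|rr * width k * u + (x0 ord0 i - z ord0 i)| < eta]).
      by apply: unif_affine_le => //; rewrite mulr_gt0.
    apply/funext => u; rewrite /slab_hit /slab_coord e0 eqxx /=.
    by congr (is_true (`|_| < _)); ring.
  rewrite lee_fin.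
  by apply: ger1_powR => //; rewrite v0 (ltW v1).
have [e1|n1] := eqVneq i i1.
  pose A (s : R) : set RR :=
    [set u | `|rr * gap k / 4 * u + (s * (rr * (1 - gap k)) + x0 ord0 i - z ord0 i)| < eta].
  have mA s : measurable (A s).
    by apply: measurable_abs_lt; exact: measurable_affine.
  have uA s : (unif (A s) <= (4 * (eta / rr) / gap k)%:E)%E.
    rewrite (_ : 4 * (eta / rr) / gap k = eta / (rr * gap k / 4)); last first.
      by field; rewrite !gt_eqF.
    by apply: unif_affine_le => //; rewrite divr_gt0 ?mulr_gt0.
  apply: (@le_trans _ _ (unif (A 1%R `|` A (-1)%R))).
    apply: le_measure; rewrite ?inE//; first exact: measurableU.
    move=> u; rewrite /slab_hit /slab_coord (negbTE n0) e1 eqxx /sgp /A /= e1.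
    case: ifP => _ h; [left|right]; apply: le_lt_trans h;
      by rewrite le_eqVlt; apply/orP; left; apply/eqP; congr `|_|; ring.
  apply: le_trans (measureU2 _ (mA _) (mA _)) _.
  apply: (le_trans (leeD (uA _) (uA _))).
  by rewrite -EFinD lee_fin -mulrDl -mulrDl; lra.
rewrite (_ : slab_hit k z eta i =
    [set u | `|rr * u + (x0 ord0 i - z ord0 i)| < eta]).
  exact: unif_affine_le.
apply/funext => u; rewrite /slab_hit /slab_coord (negbTE n0) (negbTE n1) /=.
by congr (is_true (`|_| < _)); ring.
Qed.

End CuspMeasure.

(** * Growth of the cusp measure on balls *)

Section CuspGrowth.
Context {R : realType} {d : nat}.
Local Notation E := (borel_rV R d).
Local Notation V := 'rV[R]_d.
Local Notation RR := (measurableTypeR R).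

Lemma coord_le_enorm (x : V) i : `|x ord0 i| <= enorm x.
Proof.
rewrite -(ler_pXn2r (ltn0Sn 1)) ?nnegrE ?normr_ge0 ?enorm_ge0//.
rewrite sqr_enorm /dotv (bigD1 i)//= real_normK ?num_real// expr2 lerDl.
by rewrite sumr_ge0// => j _; rewrite -expr2 sqr_ge0.
Qed.

Variable theta : R.
Hypotheses (th0 : 0 < theta) (th1 : theta <= 1).
Variables (i0 i1 : 'I_d) (i01 : i0 != i1).
Variables (x0 : V) (rr : R) (rr0 : 0 < rr).

Lemma sum_gap m : \sum_(0 <= k < m) gap k = 2 - 2 * gap m :> R.
Proof.
elim: m => [|m ih]; first by rewrite big_geq// gap_expr expr0; lra.
by rewrite big_nat_recr//= ih gapS; lra.
Qed.

Lemma prod_hit_bound k (eta : R) : 0 < eta ->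
  tail k * \prod_(i < d) hit_bound theta i0 i1 rr k eta i =
  8 * gap k * (eta / rr) `^ (d%:R - 1 + theta).
Proof.
move=> eta0; set s := eta / rr.
have s0 : 0 < s by rewrite divr_gt0.
have g0 := @gap_gt0 R k; have w0 := @width_gt0 R theta k.
rewrite (bigD1 i0)//= (bigD1 i1)/=; last by rewrite eq_sym.
have i10 : (i1 == i0) = false by rewrite eq_sym; exact/negbTE.
rewrite {1 2}/hit_bound !eqxx i10 -/s.
set rest := \prod_(i < d | _) _.
have restE : s * (s * rest) = s `^ d%:R.
  rewrite powR_mulrn ?(ltW s0)//.
  rewrite -[in RHS](card_ord d) -prodr_const (bigD1 i0)//= (bigD1 i1)/=; last by rewrite eq_sym.
  congr (_ * (_ * _)); apply: eq_bigr => i /andP[n0 n1].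
  by rewrite /hit_bound (negbTE n0) (negbTE n1).
have restE2 : rest = s `^ (d%:R - 1) / s.
  rewrite powRD; last by rewrite (gt_eqF s0) implybT.
  by rewrite powR_inv1 ?(ltW s0)// -restE; field; rewrite gt_eqF.
rewrite restE2 [in RHS]powRD; last by rewrite (gt_eqF s0) implybT.
have -> : eta / (rr * width theta k) = s / width theta k.
  by rewrite /s invfM mulrA.
rewrite powRM ?invr_ge0 ?(ltW s0) ?(ltW w0)//.
rewrite -[(width theta k)^-1]powR_inv1 ?(ltW w0)// -powRrM mulN1r powRN.
rewrite (@tail_width R theta th0).
have wt0 : width theta k `^ theta != 0 by rewrite gt_eqF// powR_gt0.
by field; rewrite wt0 !gt_eqF.
Qed.

(** A slab of thickness [t] may carry the mass [t `^ theta]: a ball of radius [eta]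
meets at most [t `^ theta * Num.min 1 (eta / t) <= eta `^ theta] of it across
the slab, as [theta <= 1]. The factor [gap k ^+ 2] of [tail k] absorbs the
shortness of the slab and makes the series over [k] converge. *)
Lemma cusp_growth : ball_growth theta (cusp theta i0 i1 x0 rr).
Proof.
exists (16 * rr^-1 `^ (d%:R - 1 + theta)).
  by apply: mulr_gt0 => //; apply: powR_gt0; rewrite invr_gt0.
move=> z eta eta0; set S := (eta / rr) `^ (d%:R - 1 + theta).
have S0 : 0 <= S by exact: powR_ge0.
have -> : 16 * rr^-1 `^ (d%:R - 1 + theta) * eta `^ (d%:R - 1 + theta) = 16 * S.
  by rewrite /S powRM ?invr_ge0 ?(ltW rr0) ?(ltW eta0)//; ring.
have slab_le k : (cube (slab_map theta i0 i1 x0 rr k @^-1` eball z eta) <=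
    (\prod_(i < d) hit_bound theta i0 i1 rr k eta i)%:E)%E.
  have mH := measurable_slab_hit theta i0 i1 x0 rr k z eta.
  have mball : measurable (eball z eta).
    rewrite (_ : eball z eta =
        (fun y : E => enorm ((y : V) - z)) @^-1` `]-oo, eta[).
      rewrite -[X in measurable X]setTI.
      have mf : measurable_fun setT (fun y : E => enorm ((y : V) - z)).
        apply: (measurableT_comp measurable_enorm).
        by apply: measurable_vecB; [exact: measurable_id|exact: measurable_cst].
      by apply: mf => //; exact: measurable_itv.
    by apply/seteqP; split => y /=; rewrite in_itv.
  apply: (@le_trans _ _ (cube [set u | forall i,
      slab_hit theta i0 i1 x0 rr k z eta i ((u : V) ord0 i)])).
    apply: le_measure; rewrite ?inE//.
    - exact: measurable_slab_preim.
    - exact: measurable_box.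
    - move=> u /= h i; rewrite /slab_hit /=.
      apply: le_lt_trans h; apply: le_trans (coord_le_enorm _ i).
      by rewrite !mxE.
  rewrite [leLHS](iid_box unif mH) lee_fin; apply: ler_prod => i _.
  by rewrite fine_ge0//= slab_hit_le.
rewrite cuspE; apply: lime_le.
  by apply: is_cvg_nneseries => k _ _; rewrite mule_ge0 ?lee_fin ?weight_ge0.
apply: nearW => m.
apply: (@le_trans _ _ (\sum_(0 <= k < m) (8 * S * gap k)%:E)%E).
  apply: lee_sum => k _.
  apply: (le_trans (lee_wpmul2l _ (slab_le k))); first by rewrite lee_fin weight_ge0.
  rewrite -EFinM lee_fin mulrAC -prod_hit_bound// ler_wpM2r//.
    apply: prodr_ge0 => i _; rewrite /hit_bound; case: ifP => _; first exact: powR_ge0.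
    case: ifP => _; rewrite ?mulr_ge0 ?invr_ge0 ?divr_ge0 ?(ltW eta0) ?(ltW rr0)//.
    exact: powR_ge0.
  by rewrite /weight gerBl ltW ?tail_gt0.
rewrite sumEFin lee_fin -mulr_sumr sum_gap.
have := @gap_gt0 R m; have := mulr_ge0 S0 (ltW (@gap_gt0 R m)); lra.
Qed.

End CuspGrowth.

(** * Tilted kinks *)

Section TiltedKinks.
Context {R : realType} {d : nat}.
Local Notation E := (borel_rV R d).
Local Notation V := 'rV[R]_d.
Variables (i0 i1 : 'I_d) (i01 : i0 != i1).
Variables (x0 y0 : V) (Delta : R) (D0 : 0 < Delta).

Definition atom (s t : R) : V :=
  y0 + s *: (Delta *: delta_mx ord0 i0 + t *: delta_mx ord0 i1).

Definition atoms (tau : R) : seq V :=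
  [:: atom 1 0; atom (-1) 0; atom 1 tau; atom (-1) tau].

Definition kink_map (a tau : R) (x : E) : E :=
  let p := (x : V) - x0 in
  if a < `|p ord0 i1| then atom (sgp (p ord0 i1)) tau
  else atom (sgp (p ord0 i0)) 0.

(** With this cost the affine function of the atom [y0 + s * (Delta e0 + t e1)] is
[s * (Delta p0 + t p1) - a * t], up to a term common to all atoms, so the
tilted pieces meet the untilted ones at [s * p1 = a]. *)
Definition atom_cost (a : R) (z : V) : R :=
  dotv x0 z + a * `|z ord0 i1 - y0 ord0 i1|.

Lemma sgp_pm (v : R) : sgp v = 1 \/ sgp v = -1.
Proof. by rewrite /sgp; case: ifP; [left|right]. Qed.

Lemma sgp_mul (v : R) : sgp v * v = `|v|.
Proof.
rewrite /sgp; case: ltrP => v0; first by rewrite mul1r gtr0_norm.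
by rewrite ler0_norm// mulN1r.
Qed.

Lemma atom_i0 s t : atom s t ord0 i0 = y0 ord0 i0 + s * Delta.
Proof.
by rewrite !mxE !eqxx /= (negbTE i01) mulr1 mulr0 addr0.
Qed.

Lemma atom_i1 s t : atom s t ord0 i1 = y0 ord0 i1 + s * t.
Proof.
by rewrite !mxE !eqxx /= eq_sym (negbTE i01) mulr1 mulr0 add0r.
Qed.

Lemma mem_atoms (s tau : R) : s = 1 \/ s = -1 ->
  atom s 0 \in atoms tau /\ atom s tau \in atoms tau.
Proof. by case=> ->; rewrite !inE !eqxx !orbT. Qed.

Lemma kink_map_atoms a tau x : (kink_map a tau x : V) \in atoms tau.
Proof.
rewrite /kink_map; case: ifP => _.
  exact: (mem_atoms tau (sgp_pm _)).2.
exact: (mem_atoms tau (sgp_pm _)).1.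
Qed.

Lemma atoms_box tau (C : R) : 0 <= tau -> tau <= C -> Delta <= C ->
  forall z, z \in atoms tau -> forall i, `|(z - y0) ord0 i| <= C.
Proof.
move=> t0 tC DC.
have C0 : 0 <= C by exact: le_trans tC.
suff box s t : `|s| = 1 -> 0 <= t -> t <= C ->
    forall i, `|(atom s t - y0) ord0 i| <= C.
  by move=> z; rewrite !inE => /or4P[] /eqP ->; apply: box;
    rewrite ?normrN ?normr1.
move=> s1 tt0 ttC i.
rewrite /atom addrAC subrr add0r mxE normrM s1 mul1r !mxE eqxx /=.
have [->|n0] := eqVneq i i0.
  by rewrite (negbTE i01) mulr1 mulr0 addr0 gtr0_norm.
rewrite mulr0 add0r; case: eqP => _; rewrite ?mulr1 ?mulr0 ?normr0//.
by rewrite ger0_norm.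
Qed.

Lemma affine_atom a s t (x : V) : s = 1 \/ s = -1 -> 0 <= t ->
  let p := x - x0 in
  dotv x (atom s t) - atom_cost a (atom s t) =
  dotv p y0 + s * (Delta * p ord0 i0 + t * p ord0 i1) - a * t.
Proof.
move=> s1 t0 p; rewrite /atom_cost atom_i1.
rewrite opprD addrA -dotvBl -/p addrAC subrr add0r.
have -> : `|s * t| = t.
  by rewrite normrM (ger0_norm t0); case: s1 => ->; rewrite ?normrN normr1 mul1r.
congr (_ - _); rewrite /atom dotvC dotvDl dotvZl dotvDl !dotvZl !dotv_delta.
by rewrite dotvC.
Qed.

(** The point is off the hyperplane, and it lies either before the threshold or so
far beyond it that the gain of the tilt exceeds the jump across the kink. *)
Definition settled (a tau : R) (x : V) : Prop :=
  let p := x - x0 in p ord0 i0 != 0 /\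
  (`|p ord0 i1| < a \/ 2 * Delta * `|p ord0 i0| < tau * (`|p ord0 i1| - a)).

(** Before the threshold the tilt is a loss, and the sign of [p0] selects the slope.
Far beyond it the tilt is worth more than the kink, so the sign of [p1] selects
it. *)
Lemma kink_map_best a tau (x : V) : 0 <= a -> 0 <= tau -> settled a tau x ->
  forall z, z \in atoms tau -> z <> kink_map a tau x ->
  dotv x z - atom_cost a z <
  dotv x (kink_map a tau x : V) - atom_cost a (kink_map a tau x).
Proof.
move=> a0 tau0 [p0 alt] z zin.
set p := x - x0 in p0 alt.
have [s [t [s1 [tE ->]]]] : exists s t, (s = 1 \/ s = -1) /\
    (t = 0 \/ t = tau) /\ z = atom s t.
  move: zin; rewrite !inE => /or4P[] /eqP ->.
  - by exists 1, 0; split; [left|split; [left|]].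
  - by exists (-1), 0; split; [right|split; [left|]].
  - by exists 1, tau; split; [left|split; [right|]].
  - by exists (-1), tau; split; [right|split; [right|]].
have t0 : 0 <= t by case: tE => ->.
rewrite /kink_map -/p.
have np0 : 0 < `|p ord0 i0| by rewrite normr_gt0.
have Dp : 0 < Delta * `|p ord0 i0| by rewrite mulr_gt0.
have bnd (v : R) : s * v <= `|v|.
  by case: s1 => ->; rewrite ?mul1r ?mulN1r ?ler_norm// -normrN ler_norm.
case: alt => [lt_a|gt_a].
  rewrite ifF; last by apply/negbTE; rewrite -leNgt ltW.
  move=> ne; rewrite !affine_atom//; last exact: sgp_pm.
  rewrite -/p mul0r addr0 mulr0 subr0 -addrA ltrD2l.
  rewrite mulrCA sgp_mul mulrDr [s * (Delta * _)]mulrCA.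
  have tp : s * (t * p ord0 i1) <= t * `|p ord0 i1|.
    by rewrite mulrCA ler_wpM2l.
  have ta : t * `|p ord0 i1| <= a * t by rewrite mulrC ler_wpM2r// ltW.
  have [es|ns] := eqVneq s (sgp (p ord0 i0)); last first.
    have -> : s * p ord0 i0 = - `|p ord0 i0|.
      rewrite -sgp_mul -mulNr; congr (_ * _).
      by case: s1 (sgp_pm (p ord0 i0)) ns => -> [] ->; rewrite ?eqxx ?opprK.
    by lra.
  rewrite es sgp_mul -es.
  have tn0 : t != 0.
    by apply/eqP => e; apply: ne; rewrite es e.
  have tgt : 0 < t by rewrite lt_neqAle eq_sym tn0.
  have : t * `|p ord0 i1| < a * t by rewrite mulrC ltr_pM2r.
  by lra.
have gap0 : 0 < tau * (`|p ord0 i1| - a) by apply: le_lt_trans gt_a; lra.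
have taugt : 0 < tau.
  by rewrite lt_neqAle tau0 andbT eq_sym; apply/eqP => e; rewrite e mul0r ltxx in gap0.
have a_lt : a < `|p ord0 i1| by move: gap0; rewrite pmulr_rgt0// subr_gt0.
rewrite a_lt => ne; rewrite !affine_atom//; last exact: sgp_pm.
rewrite -/p -!addrA ltrD2l !mulrDr.
have -> : sgp (p ord0 i1) * (tau * p ord0 i1) = tau * `|p ord0 i1|.
  by rewrite mulrCA sgp_mul.
have lo : - (Delta * `|p ord0 i0|) <= sgp (p ord0 i1) * (Delta * p ord0 i0).
  rewrite mulrCA -mulrN ler_pM2l//.
  by case: (sgp_pm (p ord0 i1)) => ->; rewrite ?mul1r ?mulN1r ?lerN2 ?ler_norm// lerNl -normrN ler_norm.
have up : s * (Delta * p ord0 i0) <= Delta * `|p ord0 i0| by rewrite mulrCA ler_pM2l.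
case: tE => te.
  by rewrite te mul0r !mulr0; lra.
have [es|ns] := eqVneq s (sgp (p ord0 i1)); first by case: ne; rewrite es te.
have -> : s * (t * p ord0 i1) = - (tau * `|p ord0 i1|).
  rewrite te mulrCA -mulrN -sgp_mul -mulNr; congr (_ * (_ * _)).
  by case: s1 (sgp_pm (p ord0 i1)) ns => -> [] ->; rewrite ?eqxx ?opprK.
have : 0 <= tau * `|p ord0 i1| by rewrite mulr_ge0.
rewrite te; have := mulr_ge0 a0 tau0; lra.
Qed.

Lemma measurable_offset i : measurable_fun setT (fun x : E => ((x : V) - x0) ord0 i).
Proof.
under eq_fun do rewrite !mxE.
by apply: measurable_funB; [exact: measurable_coord|exact: measurable_cst].
Qed.

Lemma measurable_atom_sign {d0} {T : measurableType d0} (f : T -> R) t :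
  measurable_fun setT f -> measurable_fun setT (fun x => atom (sgp (f x)) t : E).
Proof.
move=> mf.
rewrite (_ : (fun _ => _) = (fun x => if 0 < f x then atom 1 t else atom (-1) t)).
  apply: measurable_fun_ifT; [|exact: measurable_cst|exact: measurable_cst].
  by apply: measurable_fun_ltr => //; exact: measurable_cst.
by apply/funext => x; rewrite /sgp; case: ifP.
Qed.

Lemma measurable_abs_offset i : measurable_fun setT (fun x : E => `|((x : V) - x0) ord0 i|).
Proof. by apply: measurableT_comp => //; exact: measurable_offset. Qed.

Lemma measurable_kink_map a tau : measurable_fun setT (kink_map a tau).
Proof.
apply: measurable_fun_ifT.
- by apply: measurable_fun_ltr; [exact: measurable_cst|exact: measurable_abs_offset].
- by apply: measurable_atom_sign; exact: measurable_offset.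
- by apply: measurable_atom_sign; exact: measurable_offset.
Qed.

Lemma measurable_atom_cost a : measurable_fun setT (atom_cost a : E -> R).
Proof.
apply: measurable_funD.
  exact: (@measurable_dotv _ _ _ _ (fun=> x0) id).
apply: measurable_funM; first exact: measurable_cst.
apply: measurableT_comp => //.
by apply: measurable_funB; [exact: measurable_coord|exact: measurable_cst].
Qed.

Lemma measurable_lt_set {d0} {T : measurableType d0} (f g : T -> R) :
  measurable_fun setT f -> measurable_fun setT g ->
  measurable [set x | f x < g x].
Proof.
move=> mf mg; have := measurable_fun_ltr mf mg.
move=> /(_ measurableT [set true] I); rewrite setTI.
by rewrite (_ : _ @^-1` _ = [set x | f x < g x])//; apply/seteqP; split.
Qed.

Lemma measurable_le_set {d0} {T : measurableType d0} (f g : T -> R) :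
  measurable_fun setT f -> measurable_fun setT g ->
  measurable [set x | f x <= g x].
Proof.
move=> mf mg; rewrite (_ : [set x | _] = ~` [set x | g x < f x]).
  by apply: measurableC; exact: measurable_lt_set.
by apply/seteqP; split => x /=; rewrite leNgt => /negP.
Qed.

Lemma measurable_settled a tau : measurable (settled a tau : set E).
Proof.
rewrite (_ : settled a tau =
  [set x : E | 0 < `|((x : V) - x0) ord0 i0|] `&`
  ([set x : E | `|((x : V) - x0) ord0 i1| < a] `|`
   [set x : E | 2 * Delta * `|((x : V) - x0) ord0 i0| <
                tau * (`|((x : V) - x0) ord0 i1| - a)])).
  apply: measurableI.
    by apply: measurable_lt_set; [exact: measurable_cst|exact: measurable_abs_offset].
  apply: measurableU; apply: measurable_lt_set.
  - exact: measurable_abs_offset.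
  - exact: measurable_cst.
  - by apply: measurable_funM; [exact: measurable_cst|exact: measurable_abs_offset].
  - apply: measurable_funM; first exact: measurable_cst.
    by apply: measurable_funB; [exact: measurable_abs_offset|exact: measurable_cst].
by apply/seteqP; split => x; rewrite /settled /= normr_gt0.
Qed.

Lemma kink_map_tilt a tau (x : V) : 0 <= tau ->
  enorm ((kink_map a tau x : V) - kink_map a 0 x) <= tau.
Proof.
move=> tau0; rewrite /kink_map; case: ifP => _; last first.
  by rewrite subrr /enorm dotv0l sqrtr0.
set s := sgp _; rewrite /atom opprD addrACA subrr add0r -scalerBr.
rewrite scale0r addr0 addrAC subrr add0r.
rewrite /enorm dotvZl dotvC dotvZl !dotvZl dotvC dotvZl dotv_delta mxE !eqxx mulr1.
have -> : s * (s * (tau * tau)) = tau ^+ 2.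
  by case: (sgp_pm (((x : V) - x0) ord0 i1)); rewrite -/s => ->; ring.
by rewrite sqrtr_sqr ger0_norm.
Qed.

End TiltedKinks.

(** * The sharp family of targets *)

Section SharpFamily.
Context {R : realType} {d : nat}.
Local Notation E := (borel_rV R d).
Local Notation V := 'rV[R]_d.
Variable theta : R.
Hypotheses (th0 : 0 < theta) (th1 : theta <= 1).
Variables (i0 i1 : 'I_d) (i01 : i0 != i1).
Variables (x0 y0 : V) (rr Delta : R) (rr0 : 0 < rr) (D0 : 0 < Delta).

Local Notation rho := (cusp theta i0 i1 x0 rr).
Local Notation L k := (slab_map theta i0 i1 x0 rr k).
Local Notation Tm := (kink_map i0 i1 x0 y0 Delta).
Local Notation mT a tau := (measurable_kink_map i0 i1 x0 y0 Delta a tau).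

(** The index [0] stands for the untilted kink: the threshold [rr] lies beyond all
the slabs. *)
Definition kink_at n : R := if n is _.+1 then threshold rr n else rr.
Definition tilt n : R := if n is _.+1 then slope theta Delta n else 0.

Definition target n : probability E R := law rho (mT (kink_at n) (tilt n)).
Definition plan n : probability (E * E)%type R :=
  law rho (measurable_pair (@measurable_id _ E setT) (mT (kink_at n) (tilt n))).

Lemma gap_half n : gap n.+1 <= 1 / 2 :> R.
Proof. by rewrite gapS; have := @gap_le1 R n; lra. Qed.

Lemma kink_at_ge0 n : 0 <= kink_at n.
Proof.
case: n => [|n] /=; first exact: ltW.
rewrite /threshold mulr_ge0 ?(ltW rr0)//; have := gap_half n; lra.
Qed.

Lemma tilt_ge0 n : 0 <= tilt n.
Proof. by case: n => [|n] //=; rewrite slope_ge0// ltW. Qed.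

Lemma tilt_le n : tilt n <= 16 * Delta.
Proof.
case: n => [|n] /=; first by rewrite mulr_ge0// ltW.
by rewrite slope_le// ltW.
Qed.

Lemma slab_lt_rr k (u : V) : in_cube u -> `|((L k u : V) - x0) ord0 i1| < rr.
Proof.
move=> Cu; rewrite (slab_p1_norm theta i01 x0 rr0) gtr_pMr//.
have := @gap_gt0 R k; have := ler_wpM2l (ltW (@gap_gt0 R k)) (Cu i1); lra.
Qed.

Lemma slab_settled n k (u : V) : in_cube u -> u ord0 i0 != 0 ->
  settled i0 i1 x0 Delta (kink_at n) (tilt n) (L k u).
Proof.
move=> Cu u0; split.
  by rewrite slab_p0 !mulf_neq0// gt_eqF// width_gt0.
case: n => [|n] /=; first by left; exact: slab_lt_rr.
have [kn|nk] := ltnP k n.+1; first by left; exact: slab_before.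
right.
have h1 : `|((L k u : V) - x0) ord0 i0| <= rr * width theta n.+1.
  exact: slab_narrow.
have h2 := slab_after theta i01 x0 rr0 u nk.
have g0 := @gap_gt0 R n.+1; have w0 := @width_gt0 R theta n.+1.
apply: (@le_lt_trans _ _ (2 * Delta * (rr * width theta n.+1))).
  by rewrite ler_pM2l// mulr_gt0.
apply: (@lt_le_trans _ _ (slope theta Delta n.+1 * (rr * gap n.+1 / 4))).
  rewrite /slope (_ : _ * (rr * gap n.+1 / 4) =
      4 * (Delta * (rr * width theta n.+1))); last first.
    by field; rewrite gt_eqF.
  have : 0 < Delta * (rr * width theta n.+1) by rewrite !mulr_gt0.
  by lra.
apply: ler_wpM2l; first by rewrite slope_ge0// ltW.
by move: h2; rewrite /threshold; lra.
Qed.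

Definition in_box (x : V) := forall i, `|(x - x0) ord0 i| <= rr.

Lemma measurable_in_box : measurable (in_box : set E).
Proof.
rewrite (_ : in_box = \bigcap_(i in setT)
    [set x : E | `|((x : V) - x0) ord0 i| <= rr]); last first.
  by apply/seteqP; split => [x h i _|x h i]; exact: h.
apply: fin_bigcap_measurable; first exact: finite_finset.
by move=> i _; apply: measurable_le_set;
  [exact: measurable_abs_offset|exact: measurable_cst].
Qed.

Lemma ae_settled n : {ae rho, forall x : E,
  in_box x /\ settled i0 i1 x0 Delta (kink_at n) (tilt n) x}.
Proof.
pose G : set E := in_box `&` settled i0 i1 x0 Delta (kink_at n) (tilt n).
have mG : measurable G.
  by apply: measurableI; [exact: measurable_in_box|exact: measurable_settled].
exists (~` G); split => //; first exact: measurableC.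
apply: (cusp_ae i01 mG) => k u Cu u0; split.
  by move=> i; exact: slab_box.
exact: slab_settled.
Qed.

Lemma kink_map_before n k tau (u : V) : in_cube u -> (k < n)%N ->
  Tm (threshold rr n) tau (L k u) = atom i0 i1 y0 Delta (sgp (u ord0 i0)) 0.
Proof.
move=> Cu kn; rewrite /kink_map ifF; last first.
  by apply/negbTE; rewrite -leNgt ltW// slab_before.
by rewrite /sgp slab_p0_sign.
Qed.

Lemma threshold_lt n k (u : V) : in_cube u -> (n <= k)%N ->
  threshold rr n < `|((L k u : V) - x0) ord0 i1|.
Proof.
move=> Cu nk; apply: lt_le_trans (slab_after theta i01 x0 rr0 u nk).
by rewrite /threshold ltr_pM2l//; have := @gap_gt0 R n; lra.
Qed.

Lemma kink_map_after n k tau (u : V) : in_cube u -> (n <= k)%N ->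
  Tm (threshold rr n) tau (L k u) = atom i0 i1 y0 Delta (sgp (u ord0 i1)) tau.
Proof.
move=> Cu nk; rewrite /kink_map threshold_lt//.
by rewrite /sgp slab_p1_sign.
Qed.

Lemma kink_map_untilted k tau (u : V) : in_cube u ->
  Tm rr tau (L k u) = atom i0 i1 y0 Delta (sgp (u ord0 i0)) 0.
Proof.
move=> Cu; rewrite /kink_map ifF; last first.
  by apply/negbTE; rewrite -leNgt ltW// slab_lt_rr.
by rewrite /sgp slab_p0_sign.
Qed.

(** On each slab the two maps depend only on the sign of one coordinate: the first
one or, beyond the threshold, the second one. *)
Lemma untilted_law n (B : set E) : measurable B ->
  rho (Tm rr 0 @^-1` B) = rho (Tm (threshold rr n) 0 @^-1` B).
Proof.
move=> mB; apply: eq_cusp => k.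
have mpre a : measurable (L k @^-1` (Tm a 0 @^-1` B)).
  apply: measurable_slab_preim; rewrite -[X in measurable X]setTI.
  exact: measurable_kink_map.
pose g (b : bool) := B (atom i0 i1 y0 Delta (if b then 1 else -1) 0).
have mg i : measurable [set u : E | g (0 < (u : V) ord0 i)].
  have := @measurable_atom_sign _ _ i0 i1 y0 Delta _ _ _ 0 (@measurable_coord R d i).
  by move=> /(_ measurableT B mB); rewrite setTI.
transitivity (cube [set u : E | g (0 < (u : V) ord0 i0)]).
  apply: cube_congr => // u Cu /=.
  by rewrite kink_map_untilted.
have [kn|nk] := ltnP k n.
  apply: cube_congr => // u Cu /=.
  by rewrite kink_map_before.
rewrite (cube_sign_law g i01).
apply: cube_congr => // u Cu /=.
by rewrite kink_map_after.
Qed.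

(** Without the tilt, sorting by [p1] beyond the threshold gives the same target as
sorting by [p0] everywhere; so the targets differ by the tilt alone, which only
moves the slabs of index above [n]. *)
Lemma target_wasserstein n r : (1 <= r)%E ->
  (wasserstein r (target 0) (target n.+1) <=
   (wasserstein_rate (slope theta Delta n.+1) (tail n.+1) r)%:E)%E.
Proof.
move=> r1; set a := threshold rr n.+1.
apply: (@wasserstein_map_le _ _ _ _ rho (Tm a 0) (Tm a (tilt n.+1))
  (mT a 0) (mT a (tilt n.+1)) _ _ [set x : E | a < `|((x : V) - x0) ord0 i1|]) => //.
- by move=> B mB; exact: untilted_law.
- by apply: measurable_lt_set; [exact: measurable_cst|exact: measurable_abs_offset].
- have mA : measurable [set x : E | a < `|((x : V) - x0) ord0 i1|].
    by apply: measurable_lt_set; [exact: measurable_cst|exact: measurable_abs_offset].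
  rewrite (@cusp_tail _ _ _ _ _ _ _ n.+1 1)//.
  + by rewrite mul1r.
  + move=> k nk; rewrite -[RHS](@probability_setT _ _ _ (cube : probability E R)).
    apply: cube_congr => //; first exact: measurable_slab_preim.
    by move=> u Cu; split => // _; exact: threshold_lt.
  + move=> k kn; apply: cube_outside; first exact: measurable_slab_preim.
    move=> u Cu /=; apply/negP; rewrite -leNgt ltW//.
    exact: slab_before.
- by rewrite slope_ge0// ltW.
- by move=> x _; exact: (kink_map_tilt i0 i1 x0 y0 Delta a x (tilt_ge0 n.+1)).
- by move=> x /= /negP; rewrite -leNgt /kink_map => h; rewrite ltNge h.
Qed.

Definition plan_distance q n : R :=
  Num.min (rr * gap n / 4) Delta * (tail n / 4) `^ q^-1.

Lemma plan_gap_ge0 n : 0 <= Num.min (rr * gap n / 4) Delta.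
Proof.
by rewrite le_min (ltW D0) andbT divr_ge0// mulr_ge0 ?(ltW rr0)// ltW// gap_gt0.
Qed.

(** Beyond the threshold on the side [p1 > 0], the tilted plan sends the mass
[tail n.+1 / 2] near [y0 + Delta e0], the untilted plan only half of it. The
excess has to change its target by [Delta] or to cross the free interval, of
length [rr * gap n.+1 / 4]. *)
Lemma plan_wasserstein q n : 1 <= q ->
  ((plan_distance q n.+1)%:E <= wasserstein_plan q (plan 0) (plan n.+1))%E.
Proof.
move=> q1; set a := threshold rr n.+1; set b := rr * (1 - gap n.+1).
pose S0 : set (E * E) := [set z | a < ((z.1 : V) - x0) ord0 i1 /\
  y0 ord0 i0 < (z.2 : V) ord0 i0].
pose S1 : set (E * E) := [set z | b <= ((z.1 : V) - x0) ord0 i1 /\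
  y0 ord0 i0 + Delta <= (z.2 : V) ord0 i0].
have mp1 : measurable_fun setT (fun z : E * E => ((z.1 : V) - x0) ord0 i1).
  exact: measurableT_comp (measurable_offset x0 i1) measurable_fst.
have my0 : measurable_fun setT (fun z : E * E => (z.2 : V) ord0 i0).
  exact: measurableT_comp (measurable_coord i0) measurable_snd.
have mS0 : measurable S0.
  by apply: measurableI; apply: measurable_lt_set => //; exact: measurable_cst.
have mS1 : measurable S1.
  by apply: measurableI; apply: measurable_le_set => //; exact: measurable_cst.
have a0 : 0 <= a by exact: (kink_at_ge0 n.+1).
have b0 : 0 < b by rewrite mulr_gt0// ; have := gap_half n; lra.
have ab : b - a = rr * gap n.+1 / 4 by rewrite /a /b /threshold; field.
have g0 := @gap_gt0 R n.+1.
have ab0 : a < b by rewrite -subr_gt0 ab divr_gt0// mulr_gt0.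
have meas_pair a' tau (S : set (E * E)) : measurable S ->
    measurable ((fun x : E => (x, Tm a' tau x)) @^-1` S).
  move=> mS; rewrite -[X in measurable X]setTI.
  exact: (measurable_pair (@measurable_id _ E setT) (mT a' tau)).
have pS0 : (plan 0 S0 <= (4^-1 * tail n.+1)%:E)%E.
  rewrite [leLHS](_ : _ = rho ((fun x : E => (x, Tm rr 0 x)) @^-1` S0))//.
  have mpre := meas_pair rr 0 S0 mS0.
  rewrite (@cusp_tail _ _ _ _ _ _ _ n.+1 4^-1)//.
  - move=> k nk; rewrite -(cube_quarter true true i01).
    apply: cube_congr.
    + exact: measurable_slab_preim.
    + exact: (measurableI _ _ (measurable_sign_coord i0 true)
        (measurable_sign_coord i1 true)).
    move=> u Cu; rewrite /S0 /= kink_map_untilted// atom_i0//.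
    have := threshold_lt Cu nk; rewrite -/a.
    have := slab_p1_sign theta i01 x0 rr0 k u.
    set p := _ ord0 i1 => ps pa.
    rewrite ltrDl pmulr_lgt0// /sgp; split.
      move=> [ap]; case: ifP => [u0 _|_]; last by rewrite ltr0N1.
      by split => //; rewrite -ps (le_lt_trans a0).
    move=> [-> u1]; split => //.
    by move: pa; rewrite gtr0_norm// ps u1.
  - move=> k kn; apply: cube_outside; first exact: measurable_slab_preim.
    move=> u Cu [/= ap _]; have := slab_before theta i01 x0 rr0 Cu kn.
    by rewrite ltNge => /negP; apply; rewrite (le_trans (ltW ap))// ler_norm.
have pS1 : ((2^-1 * tail n.+1)%:E <= plan n.+1 S1)%E.
  rewrite [leRHS](_ : _ = rho ((fun x : E => (x, Tm a (tilt n.+1) x)) @^-1` S1))//.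
  have mpre := meas_pair a (tilt n.+1) S1 mS1.
  rewrite (@cusp_tail _ _ _ _ _ _ _ n.+1 2^-1)//.
  - have i10 : i1 != i0 by rewrite eq_sym.
    move=> k nk; rewrite -(cube_half true i10).
    apply: cube_congr.
    + exact: measurable_slab_preim.
    + exact: (measurable_sign_coord i1 true).
    move=> u Cu; rewrite /S1 /= kink_map_after// atom_i0//.
    have := slab_after theta i01 x0 rr0 u nk; rewrite -/b.
    have := slab_p1_sign theta i01 x0 rr0 k u.
    set p := _ ord0 i1 => ps pb; split.
      by move=> [bp _]; rewrite -ps (lt_le_trans b0).
    move=> u1; rewrite /sgp u1 mul1r lexx; split => //.
    by move: pb; rewrite gtr0_norm// ps u1.
  - move=> k kn; apply: cube_outside; first exact: measurable_slab_preim.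
    move=> u Cu [/= bp _]; have := slab_before theta i01 x0 rr0 Cu kn.
    rewrite ltNge => /negP; apply; rewrite (le_trans (ltW ab0))// (le_trans bp)//.
    exact: ler_norm.
have t0 := @tail_gt0 R n.+1.
rewrite /plan_distance (_ : tail n.+1 / 4 = 2^-1 * tail n.+1 - 4^-1 * tail n.+1); last by field.
apply: (wasserstein_plan_ge q1 (plan_gap_ge0 n.+1) _ mS0 mS1 pS0 pS1).
  by rewrite ler_pM2r//; lra.
move=> z0 z1 nS0 [/= bz1 Dz1].
have [az0|az0] := ltrP a (((z0.1 : V) - x0) ord0 i1); [right|left].
  have yz0 : (z0.2 : V) ord0 i0 <= y0 ord0 i0.
    by rewrite leNgt; apply/negP => h; apply: nS0.
  apply: le_trans (coord_le_enorm _ i0); rewrite ge_min; apply/orP; right.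
  rewrite !mxE -normrN opprB ler_normr; apply/orP; left.
  by move: yz0 Dz1; lra.
apply: le_trans (coord_le_enorm _ i1); rewrite ge_min; apply/orP; left.
rewrite -ab; move: az0 bz1; rewrite !mxE => h1 h2.
by rewrite -normrN opprB ler_normr; apply/orP; left; lra.
Qed.

Section InDomains.
Variables (X Y : set V) (KX KY : R).
Hypothesis bX : forall x, X x -> forall i, `|x ord0 i| <= KX.
Hypothesis bY : forall y, Y y -> forall i, `|y ord0 i| <= KY.
Hypothesis boxX : forall x : V, in_box x -> X° x.
Hypothesis boxY : forall y : V, (forall i, `|(y - y0) ord0 i| <= 16 * Delta) -> Y y.

Let XW x : X° x -> X x. Proof. exact: interior_subset. Qed.

Let Xx0 : X x0.
Proof.
by apply/XW/boxX => i; rewrite subrr mxE normr0 ltW.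
Qed.

Lemma atomsY n z : z \in atoms i0 i1 y0 Delta (tilt n) -> Y z.
Proof.
move=> zin; apply: boxY.
apply: (atoms_box i01 D0 (tilt_ge0 n) (tilt_le n)) zin.
by have := D0; lra.
Qed.

Lemma cusp_on : measurable (X : set E) -> prob_on X rho.
Proof.
move=> mX; rewrite /prob_on.
have [N [mN N0 XN]] := ae_settled 0.
have e : rho (~` (X : set E)) = 0%E.
  apply: (cusp_ae i01 mX) => k u Cu u0.
  by apply/XW/boxX => i; exact: slab_box.
have := probability_setC rho (measurableC mX); rewrite setCK => ->.
by rewrite [X in (_ - X)%E]e sube0.
Qed.

Lemma target_on n : prob_on Y (target n).
Proof.
rewrite /prob_on [LHS](_ : _ = rho (Tm (kink_at n) (tilt n) @^-1` Y))//.
rewrite (_ : _ @^-1` _ = setT); first exact: probability_setT.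
by apply/seteqP; split => // x _; exact/atomsY/kink_map_atoms.
Qed.

Lemma plan_unique n : unique_optimal_plan rho (target n) (plan n).
Proof.
pose a := kink_at n; pose tau := tilt n.
have [K1 hK1] := seq_bounded (atoms i0 i1 y0 Delta tau)
  (fun z => dotv z z - 2 * atom_cost i1 x0 y0 a z).
have [K2 hK2] := seq_bounded (atoms i0 i1 y0 Delta tau) (atom_cost i1 x0 y0 a).
pose K3 := d%:R * (KX * KX) + 2 * (d%:R * (KX * KY) + K2).
apply: (@unique_optimal_graph _ _ rho _ (mT a tau)
  [set` atoms i0 i1 y0 Delta tau] (measurable_seq _)
  (atom_cost i1 x0 y0 a) (measurable_atom_cost i1 x0 y0 a) (Num.max K1 K3)).
- by move=> x; exact: kink_map_atoms.
- apply: filterS (ae_settled n) => x [bx sx]; split; last first.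
    by move=> z zin; exact: (kink_map_best i01 D0 (kink_at_ge0 n) (tilt_ge0 n) sx).
  have Xx := XW (boxX bx); rewrite le_max; apply/orP; right.
  have h1 := dotv_bound (bX Xx) (bX Xx).
  have Tin := kink_map_atoms i0 i1 x0 y0 Delta a tau x.
  have h2 := dotv_bound (bX Xx) (bY (atomsY Tin)).
  have h3 := hK2 _ Tin.
  move: h1 h2 h3; rewrite !ler_norml /K3 => /andP[? ?] /andP[? ?] /andP[? ?].
  by apply/andP; split; lra.
- by move=> z zin; rewrite le_max hK1.
Qed.

Definition potential n : V -> R := bidual_potential X Y
  (atoms i0 i1 y0 Delta (tilt n)) (atom i0 i1 y0 Delta 1 0)
  (atom_cost i1 x0 y0 (kink_at n)).

Let atom_in n : atom i0 i1 y0 Delta 1 0 \in atoms i0 i1 y0 Delta (tilt n).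
Proof. by rewrite !inE eqxx. Qed.

Lemma potential_brenier n : brenier_potential X Y rho (target n) (potential n).
Proof.
apply: (bidual_brenier (mT (kink_at n) (tilt n)) bX bY Xx0 (atom_in n)
  (@atomsY n) (measurable_atom_cost i1 x0 y0 (kink_at n))).
- exact: kink_map_atoms.
- apply: filterS (ae_settled n) => x [bx sx]; split; first exact/XW/boxX.
  exact: (kink_map_best i01 D0 (kink_at_ge0 n) (tilt_ge0 n) sx).
Qed.

Lemma potential_grad n : {ae rho, forall x : E,
  grad (potential n) x = Tm (kink_at n) (tilt n) x}.
Proof.
apply: filterS (ae_settled n) => x [bx sx].
apply: (grad_bidual bX bY Xx0 (atom_in n) (@atomsY n)).
- exact: boxX.
- exact: kink_map_atoms.
- exact: (kink_map_best i01 D0 (kink_at_ge0 n) (tilt_ge0 n) sx).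
Qed.

(** The gradients are opposite, up to the tilt, on the part of the slabs with
[p1 > 0] beyond the threshold and [p0 <= 0], of mass [tail n.+1 / 4]. *)
Lemma potential_distance q n : 1 <= q ->
  ((plan_distance q n.+1)%:E <= Lnorm rho q%:E (fun x : E =>
     (enorm (grad (potential 0) x - grad (potential n.+1) x))%:E))%E.
Proof.
move=> q1; set a := threshold rr n.+1.
pose S : set E := [set x | a < ((x : V) - x0) ord0 i1 /\ ((x : V) - x0) ord0 i0 <= 0].
have mS : measurable S.
  apply: measurableI.
    by apply: measurable_lt_set; [exact: measurable_cst|exact: measurable_offset].
  by apply: measurable_le_set; [exact: measurable_offset|exact: measurable_cst].
have a0 : 0 <= a by exact: (kink_at_ge0 n.+1).
have t0 := @tail_gt0 R n.+1.
have pS : ((tail n.+1 / 4)%:E <= rho S)%E.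
  rewrite (@cusp_tail _ _ _ _ _ _ _ n.+1 4^-1)//; first by rewrite mulrC.
  - move=> k nk; rewrite -(cube_quarter false true i01).
    apply: cube_congr.
    + exact: measurable_slab_preim.
    + exact: (measurableI _ _ (measurable_sign_coord i0 false)
        (measurable_sign_coord i1 true)).
    move=> u Cu; rewrite /S /=.
    have := threshold_lt Cu nk; rewrite -/a.
    have := slab_p1_sign theta i01 x0 rr0 k u.
    set p := _ ord0 i1 => ps pa.
    rewrite leNgt (slab_p0_sign theta i0 i1 x0 rr0).
    split.
      by move=> [ap /negbTE ->]; rewrite -ps (le_lt_trans a0).
    move=> [-> u1]; split => //.
    by move: pa; rewrite gtr0_norm// ps u1.
  - move=> k kn; apply: cube_outside; first exact: measurable_slab_preim.
    move=> u Cu [/= ap _]; have := slab_before theta i01 x0 rr0 Cu kn.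
    by rewrite ltNge => /negP; apply; rewrite (le_trans (ltW ap))// ler_norm.
apply: (Lnorm_ge_on q1 (plan_gap_ge0 n.+1) _ mS pS).
  by rewrite divr_ge0// ltW.
have g0 := potential_grad 0; have gn := potential_grad n.+1.
have s0 := ae_settled 0.
near=> x => -[ax px0].
have -> : grad (potential 0) x = Tm rr 0 x by near: x; exact: g0.
have -> : grad (potential n.+1) x = Tm a (tilt n.+1) x by near: x; exact: gn.
have bx : in_box x.
  have [] : in_box x /\ settled i0 i1 x0 Delta (kink_at 0) (tilt 0) x by near: x; exact: s0.
  by [].
rewrite ge_min; apply/orP; right.
apply: le_trans (coord_le_enorm _ i0).
rewrite /kink_map ifF; last by apply/negbTE; rewrite -leNgt; exact: bx.
have ap : a < `|((x : V) - x0) ord0 i1| by rewrite (lt_le_trans ax)// ler_norm.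
rewrite ap [X in `|X|]mxE [X in _ + X]mxE !atom_i0//.
rewrite /sgp ltNge px0 /= (le_lt_trans a0 ax).
rewrite -normrN ler_normr; apply/orP; left.
by have := D0; lra.
Unshelve. all: by end_near. Qed.

End InDomains.

End SharpFamily.

(** * The sharpness theorem *)

Section Domains.
Context {R : realType} {d : nat}.
Local Notation V := 'rV[R]_d.

Lemma compact_coord_bounded (X : set V) : compact X ->
  exists K : R, forall x, X x -> forall i, `|x ord0 i| <= K.
Proof.
move=> /compact_bounded [M [_ hM]]; exists (M + 1) => x Xx i.
by apply: le_trans (coord_le_norm x i) _; apply: hM => //; rewrite ltrDl.
Qed.

Lemma interior_box (X : set V) : X° !=set0 ->
  exists (x0 : V) (r : R), 0 < r /\
    forall x, (forall i, `|(x - x0) ord0 i| <= r) -> X° x.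
Proof.
move=> [x0 Xx0]; have := @open_interior _ X; rewrite openE => /(_ _ Xx0).
move=> /nbhs_ballP [e /= e0 eX]; exists x0, (e / 2).
have e20 : 0 < e / 2 by rewrite divr_gt0.
split => // x hx; apply: eX; rewrite -ball_normE /= distrC.
rewrite /Num.Def.normr /= mx_normrE; apply/bigmax_ltP; split => // -[i j] _ /=.
by rewrite ord1; apply: le_lt_trans (hx j) _; lra.
Qed.

End Domains.

Lemma limn_esup_pinfty (R : realType) (u : (\bar R)^nat) :
  (forall A : R, 0 <= A -> exists N, forall n, (N <= n)%N -> (A%:E <= u n)%E) ->
  limn_esup u = +oo%E.
Proof.
move=> uA; have uoo : u n @[n --> \oo] --> +oo%E.
  apply/cvgeyPge => A; have [N hN] := uA _ (normr_ge0 A).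
  near=> n; apply: (@le_trans _ _ `|A|%:E); first by rewrite lee_fin ler_norm.
  by apply: hN; near: n; exact: nbhs_infty_ge.
rewrite is_cvg_limn_esupE; first exact: cvg_lim.
by apply/cvg_ex; exists +oo%E.
Unshelve. all: by end_near. Qed.

Lemma le_ereal_ratio (R : realType) (A v : R) (x y : \bar R) :
  0 <= A -> 0 < v -> (0 <= y)%E -> (y <= v%:E)%E -> ((A * v)%:E <= x)%E ->
  (A%:E <= x / y)%E.
Proof.
move=> A0 v0 y0 yv Avx.
have Vv : ((v^-1)%:E <= y^-1)%E.
  have -> : (v^-1)%:E = (v%:E^-1)%E by rewrite inver gt_eqF.
  by rewrite lee_pV2 ?inE ?lee_fin ?(ltW v0).
have -> : A%:E = ((A * v)%:E * (v^-1)%:E)%E.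
  by rewrite -EFinM mulfK// gt_eqF.
by apply: lee_pmul; rewrite ?lee_fin ?mulr_ge0 ?invr_ge0 ?(ltW v0).
Qed.

(* In the extended reals 0^-1 = +oo and 0 * +oo = 0, so an index i with
   mu i = mu 0 contributes the value 0 to the upper limit. *)
Theorem proposition5p2 (R : realType) (d : nat) (theta : R)
    (X Y : set 'rV[R]_d) :
  (2 <= d)%N -> 0 < theta -> theta <= 1 ->
  compact X -> convex_set X -> X° !=set0 ->
  compact Y -> convex_set Y -> Y° !=set0 ->
  exists rho : probability (borel_rV R d) R,
    [/\ prob_on X rho,
        ball_growth theta rho,
        exists (mu : nat -> probability (borel_rV R d) R)
               (gamma : nat ->
                  probability (borel_rV R d * borel_rV R d)%type R),
          [/\ forall i, prob_on Y (mu i),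
              forall i, unique_optimal_plan rho (mu i) (gamma i) &
              forall (q : R) (r : \bar R) (alpha : R),
                1 <= q -> (1 <= r)%E -> critical_exponent theta q r < alpha ->
                limn_esup (fun i => wasserstein_plan q (gamma 0%N) (gamma i) /
                                    wasserstein r (mu 0%N) (mu i) `^ alpha)%E
                = +oo%E],
        forall q beta : R, 1 <= q -> theta / (q * (1 + theta)) < beta ->
          ~ exists C : R, potential_stability X Y rho q beta C &
        forall q beta : R, 1 <= q -> theta / (q * (1 + theta)) < beta ->
          ~ exists C : R, plan_stability X Y rho q beta C].
Proof.
move=> d2 th0 th1 cX _ iX cY _ iY.
pose i0 : 'I_d := Ordinal (ltnW d2); pose i1 : 'I_d := Ordinal d2.
have i01 : i0 != i1 by [].
have [KX bX] := compact_coord_bounded cX.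
have [KY bY] := compact_coord_bounded cY.
have [x0 [rr [rr0 boxX]]] := interior_box iX.
have [y0 [rY [rY0 boxY0]]] := interior_box iY.
pose Delta := rY / 16.
have D0 : 0 < Delta by rewrite divr_gt0.
have boxY (y : 'rV[R]_d) : (forall i, `|(y - y0) ord0 i| <= 16 * Delta) -> Y y.
  move=> h; apply: (@interior_subset _ Y); apply: boxY0 => i; apply: le_trans (h i) _.
  by rewrite /Delta mulrC divfK.
pose rho := cusp theta i0 i1 x0 rr.
pose mu := target theta i0 i1 x0 y0 rr Delta.
pose gam := plan theta i0 i1 x0 y0 rr Delta.
have rhoX : prob_on X rho.
  apply: (cusp_on th0 th1 i01 rr0 D0 boxX).
  by apply: measurable_closed; apply: compact_closed cX; exact: norm_hausdorff.
have muY n : prob_on Y (mu n) by exact: target_on.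
have gam_unique n : unique_optimal_plan rho (mu n) (gam n).
  exact: (plan_unique th0 th1 i01 rr0 D0 bX bY boxX boxY).
have rate_gt0 n r : 0 < wasserstein_rate (slope theta Delta n) (tail n) r.
  rewrite wasserstein_rateE; apply: mulr_gt0; last exact/powR_gt0/tail_gt0.
  apply: mulr_gt0; first exact: mulr_gt0.
  by apply: divr_gt0; [exact: width_gt0|exact: gap_gt0].
have W_rate n r (al : R) : (1 <= r)%E -> 0 <= al ->
    (wasserstein r (mu 0%N) (mu n.+1) `^ al <=
     (wasserstein_rate (slope theta Delta n.+1) (tail n.+1) r `^ al)%:E)%E.
  move=> r1 al0; rewrite -poweR_EFin; apply: poweR_le => //.
    exact: wasserstein_ge0.
  exact: target_wasserstein.
(* Both stability inequalities would bound [plan_distance] by a constant times a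
   power, above the critical exponent, of the Wasserstein distance. *)
have blowup q beta C : 1 <= q -> theta / (q * (1 + theta)) < beta ->
    (forall n, ((plan_distance rr Delta q n.+1)%:E <=
      C%:E * (wasserstein 1 rho rho + wasserstein 1 (mu 0%N) (mu n.+1)) `^ beta)%E) ->
    False.
  move=> q1 crit bound.
  have crit1 : critical_exponent theta q 1%E < beta by rewrite /= mul1r.
  have [b0 _ _] := critical_exponent_gain th0 q1 (lexx 1%E) crit1.
  have [N hN] := plan_gap_dominates th0 (`|C| + 1) rr0 D0 q1 (lexx 1%E) crit1.
  have := hN N.+1 (leqnSn N); rewrite leNgt => /negP; apply.
  set w := wasserstein_rate _ _ _ `^ beta.
  have w0 : 0 < w by rewrite powR_gt0.
  apply: (@le_lt_trans _ _ (`|C| * w)); last by rewrite mulrDl mul1r ltrDl.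
  rewrite -lee_fin; apply: le_trans (bound N) _.
  rewrite wasserstein_self add0e EFinM.
  apply: (@le_trans _ _ (`|C|%:E * wasserstein 1 (mu 0%N) (mu N.+1) `^ beta)%E).
    by apply: lee_wpmul2r; [exact: poweR_ge0|rewrite lee_fin ler_norm].
  by apply: lee_wpmul2l => //; apply: W_rate => //; exact: ltW.
exists rho; split => //.
- exact: cusp_growth.
- exists mu, gam; split => // q r alpha q1 r1 crit.
  apply: limn_esup_pinfty => A A0.
  have [al0 _ _] := critical_exponent_gain th0 q1 r1 crit.
  have [N hN] := plan_gap_dominates th0 A rr0 D0 q1 r1 crit.
  exists N.+1 => -[//|n] Nn.
  apply: (le_ereal_ratio A0 (powR_gt0 alpha (rate_gt0 n.+1 r))).
  + exact: poweR_ge0.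
  + by apply: W_rate => //; exact: ltW.
  + have h : ((plan_distance rr Delta q n.+1)%:E <=
        wasserstein_plan q (gam 0%N) (gam n.+1))%E by exact: plan_wasserstein.
    by apply: (le_trans _ h); rewrite lee_fin; apply: hN; exact: ltnW.
- move=> q beta q1 crit [C stab]; apply: (blowup q beta C q1 crit) => n.
  apply: le_trans (potential_distance th0 th1 i01 rr0 D0 bX bY boxX boxY n q1) _.
  apply: stab => //; exact: (potential_brenier th0 th1 i01 rr0 D0 bX bY boxX boxY).
- move=> q beta q1 crit [C stab]; apply: (blowup q beta C q1 crit) => n.
  have h : ((plan_distance rr Delta q n.+1)%:E <=
      wasserstein_plan q (gam 0%N) (gam n.+1))%E by exact: plan_wasserstein.
  apply: le_trans h _.
  by apply: stab => //; [exact: (gam_unique 0%N).1|exact: (gam_unique n.+1).1].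
Qed.
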